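(* Let $T>0$, $n\geqslant 1$, and let $v=(v_1,\dots,v_n)\colon\mathbb{R}\times\mathbb{R}^n\times\mathbb{R}^n\to\mathbb{R}^n$, $(t,x,\dot x)\mapsto v(t,x,\dot x)$, be an infinitely smooth map that is $T$-periodic in $t$. Suppose there are $2n$ infinitely smooth $T$-periodic functions $x_1^j,x_2^j\colon\mathbb{R}\to\mathbb{R}$, $1\leqslant j\leqslant n$, such that for all $t\in\mathbb{R}$ and all $1\leqslant j\leqslant n$: 1. $x_1^j(t)<x_2^j(t)$; 2. $\ddot x_1^j(t)>v_j(t,y,w)$ for all $y=(y_1,\dots,y_n)\in\mathbb{R}^n$ and $w=(w_1,\dots,w_n)\in\mathbb{R}^n$ such that $y_j=x_1^j(t)$, $w_j=\dot x_1^j(t)$, and, for $i\neq j$, $y_i\in[x_1^i(t),x_2^i(t)]$ and $w_i\in\mathbb{R}$ is arbitrary; 3. $\ddot x_2^j(t)<v_j(t,y,w)$ for all $y,w\in\mathbb{R}^n$ such that $y_j=x_2^j(t)$, $w_j=\dot x_2^j(t)$, and, for $i\neq j$, $y_i\in[x_1^i(t),x_2^i(t)]$ and $w_i\in\mathbb{R}$ is arbitrary. Assume moreover that there are constants $a$, $b$ and $\delta>0$ such that $\|v(t,x,\dot x)\|\leqslant a+b\|\dot x\|^{2-\delta}$ for all $t,x,\dot x$. Then the system $$\ddot x_j=v_j(t,x,\dot x),\qquad j=1,\dots,n,$$ where $x=(x_1,\dots,x_n)$, has a $T$-periodic solution $x(t)=(x_1(t),\dots,x_n(t))$ such that $x_1^j(t)<x_j(t)<x_2^j(t)$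 for all $t\in\mathbb{R}$ and all $1\leqslant j\leqslant n$.
   Context: Dots denote derivatives with respect to $t$; when used as an argument of $v$, $\dot x$ is an independent variable in $\mathbb{R}^n$. The upper index $j$ in $x_1^j,x_2^j$ is a label (not a power), $x_1^j$ and $x_2^j$ being the lower and upper bounding functions for the $j$-th coordinate. $\|\cdot\|$ is the Euclidean norm on $\mathbb{R}^n$. *)

(* Defs.v *)
From HB Require Import structures.
From mathcomp Require Import all_boot all_order all_algebra.
From mathcomp Require Import all_classical all_reals all_analysis.

Set Implicit Arguments.
Unset Strict Implicit.
Unset Printing Implicit Defensive.

Import Order.TTheory GRing.Theory Num.Theory numFieldNormedType.Exports.

Local Open Scope ring_scope.
Local Open Scope classical_set_scope.

(* Class C^k: every iterated directional derivative of order at most k exists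
   everywhere and is continuous. In finite dimension, letting the directions
   range over all vectors or only over a basis (partial derivatives) gives the
   same class. *)
Fixpoint Ck (R : realType) (V W : normedModType R) (k : nat) (f : V -> W)
    : Prop :=
  match k with
  | 0 => continuous f
  | k'.+1 => continuous f /\
      forall u : V, (forall a : V, derivable f a u) /\ Ck k' ('D_u f)
  end.

Definition smooth (R : realType) (V W : normedModType R) (f : V -> W) : Prop :=
  forall k : nat, Ck k f.

(* The library norm `|u| on 'rV[R]_n is the sup norm, hence this definition. *)
Definition euclidean_norm (R : realType) (n : nat) (u : 'rV[R]_n) : R :=
  Num.sqrt (\sum_(i < n) u 0 i ^+ 2).

(* The argument of v is the triple (t, x, x'). *)
Definition is_solution (R : realType) (n : nat)
    (v : R * 'rV[R]_n * 'rV[R]_n -> 'rV[R]_n) (x : R -> 'rV[R]_n) : Prop :=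
  forall t : R,
    [/\ derivable x t 1,
        derivable x^`() t 1 &
        forall j : 'I_n, x^`(2) t 0 j = v (t, x t, x^`() t) 0 j].

(* Main.v *)
Require Import Defs.
From HB Require Import structures.
From mathcomp Require Import all_boot all_order all_algebra.
From mathcomp Require Import all_classical all_reals all_analysis.
From mathcomp Require Import ring lra zify.
Import Order.TTheory GRing.Theory Num.Theory numFieldNormedType.Exports.
Local Open Scope ring_scope.
Local Open Scope classical_set_scope.

(** The solution is a limit of solutions of a finite difference scheme, and
    the scheme is solved by a discrete form of the Poincare-Miranda theorem.

    Fix a level N and replace the velocity w by its coordinatewise clamp to
    [-N, N], which makes the right-hand side bounded on the tube between the
    bounding functions. On the grid k h with h = T / m, the unknowns of

      Y (k + 1) - 2 Y k + Y (k - 1) = h ^ 2 v (k h, Y k, clamp ((Y k - Y (k - 1)) / h)),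

    taken m-periodic in k, range over a product of intervals, one for each
    pair of a grid point and a coordinate, from x1 + eta to x2 - eta. On the
    face where Y k j equals x1 j + eta the second difference dominates the
    force (face_estimate): either the backward velocity is close to the
    derivative of x1 j and the strict inequality assumed on x1 applies, with a
    margin that compactness makes uniform (face_margin), or the neighbour
    Y (k - 1) j lies so far above x1 j that the second difference is of order
    h, against a force term of order h ^ 2. On the upper faces the signs are
    reversed, so the residual has an approximate zero in the box
    (poincare_miranda_approx, scheme_solution).

    The Poincare-Miranda property itself comes from counting modulo 2. For
    0-1 colourings c_1, ..., c_n of a cubical grid, the cup product of their
    coboundaries is a cocycle; by telescoping, its sum over the grid reduces
    to one face at a time and equals 1 as soon as c_i is 0 on the i-th lower
    face and 1 on the i-th upper face (box_walk_sum). Hence all the colours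
    change within a single cell (cell_all_colors); colouring by the signs of
    the components of a map gives a point where all of them are small.

    The scheme bounds the backward differences and their increments uniformly
    in h. An ultrafilter on the sequence of step sizes then provides limits x
    of the grid solutions and w of their backward differences at every time,
    and the equicontinuity of the increments gives x' = w and
    w' = v (t, x, clamp w) without integration (limit_derivative,
    truncated_solution). The margin eta keeps x strictly inside the tube.

    Finally the level N can be chosen so that the clamp is inactive. With B a
    bound of x and K a bound of x'', Landau's inequality bounds x' by N as
    soon as 8 B K <= N ^ 2, and the growth assumption bounds K by a constant
    plus a multiple of N ^ (2 - delta), which is negligible against N ^ 2
    (landau_inequality, subquadratic_level). *)

Set Implicit Arguments.
Unset Strict Implicit.
Unset Printing Implicit Defensive.

(** * Colourings of the cubical grid, modulo 2 *)

Section Cube.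
Variable I : finType.
Implicit Types (D : {set I}) (p q r : I -> nat) (d e i : I).

Definition bump_at d p : I -> nat := fun i => (p i + (i == d))%N.
Definition set_at p d k : I -> nat := fun i => if i == d then k else p i.

Lemma F2_addrr (x : 'F_2) : x + x = 0.
Proof. by apply: addrr_pchar2; exact: pchar_Fp. Qed.

Lemma F2_neq01 (x : 'F_2) : x != 0 -> x = 1.
Proof. by case: x => -[|[|//]] // i _; apply/val_inj. Qed.

Lemma bump_atC d e p : bump_at d (bump_at e p) = bump_at e (bump_at d p).
Proof. by apply/funext => i; rewrite /bump_at addnAC. Qed.

(** Ordered pairs of distinct elements come in couples (d, e), (e, d) whose
    contributions cancel in characteristic 2. *)
Lemma sum_sym_pairs D (F : I -> I -> 'F_2) :
  (forall d e, F d e = F e d) -> \sum_(d in D) \sum_(e in D :\ d) F d e = 0.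
Proof.
move=> symF.
pose lt d e := (enum_rank d < enum_rank e)%N.
have -> : \sum_(d in D) \sum_(e in D :\ d) F d e =
  \sum_(d in D) \sum_(e in D | lt d e) F d e +
  \sum_(d in D) \sum_(e in D | lt e d) F d e.
  rewrite -big_split; apply: eq_bigr => d dD /=.
  rewrite (bigID (lt d)) /=; congr (_ + _); apply: eq_bigl => e;
    rewrite !inE /lt -(inj_eq enum_rank_inj) -val_eqE /=;
    by case: (e \in D); rewrite ?andbF ?andbT //; lia.
rewrite [X in _ + X](exchange_big_dep (mem D)) /=; last by move=> ? ? _ /andP[].
rewrite -[RHS](F2_addrr (\sum_(d in D) \sum_(e in D | lt d e) F d e)).
by congr (_ + _); apply: eq_bigr => d dD; rewrite dD /=; apply: eq_bigr.
Qed.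

(** The cup product of the coboundaries of the cochains cs, on the cube with
    corner p and directions D: each term is a monotone lattice path along edges
    of the cube, its i-th step contributing the variation of the i-th cochain. *)
Fixpoint walk_sum (cs : seq ((I -> nat) -> 'F_2)) D p : 'F_2 :=
  if cs is c :: cs' then
    \sum_(d in D) (c (bump_at d p) + c p) * walk_sum cs' (D :\ d) (bump_at d p)
  else 1.

(** A product of coboundaries is a cocycle: with one factor fewer than there are
    directions, this says that its sum over the faces of a cube vanishes. The faces
    of the cube with directions D come in pairs, D :\ d based at the two ends of
    an edge in direction d. *)
Lemma walk_sum_closed cs D p :
  \sum_(d in D) walk_sum cs (D :\ d) (bump_at d p) =
  \sum_(d in D) walk_sum cs (D :\ d) p.
Proof.
elim: cs D p => [|c cs IH] D p //=.
have sw d e : D :\ d :\ e = D :\ e :\ d by rewrite !finset.setDDl finset.setUC.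
(* Both sides reduce to B: terms symmetric in the two directions cancel, and
   the induction hypothesis moves the base point of the inner sums. *)
pose B := \sum_(d in D) c (bump_at d p) *
   \sum_(e in D :\ d) walk_sum cs (D :\ d :\ e) (bump_at d p).
transitivity B.
  under eq_bigr => d _ do under eq_bigr => e _ do rewrite mulrDl.
  under eq_bigr => d _ do rewrite big_split /= -mulr_sumr IH.
  rewrite big_split /= sum_sym_pairs ?add0r // => d e.
  by rewrite sw bump_atC.
under [RHS]eq_bigr => d _ do under eq_bigr => e _ do rewrite mulrDl.
under [RHS]eq_bigr => d _ do rewrite big_split /= -mulr_sumr IH.
rewrite big_split /=.
have -> : \sum_(d in D) c p * \sum_(e in D :\ d) walk_sum cs (D :\ d :\ e) p = 0.
  rewrite -mulr_sumr sum_sym_pairs ?mulr0 // => d e; by rewrite sw.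
rewrite addr0 /B.
rewrite (exchange_big_dep (mem D)) /=; last by move=> d e _; rewrite inE => /andP[].
apply: eq_bigr => e eD; rewrite mulr_sumr; apply: eq_big => d.
  by rewrite !inE eD andbT andbC eq_sym.
by rewrite sw.
Qed.

Variable N : nat.

(** The sum over the points with coordinates below N in the directions ds and
    those of p elsewhere. Iterating over a list makes every direction available
    for telescoping without reindexing. *)
Fixpoint box_sum (ds : seq I) (F : (I -> nat) -> 'F_2) p : 'F_2 :=
  if ds is d :: ds' then \sum_(k < N) box_sum ds' F (set_at p d k) else F p.

Lemma eq_box_sum ds F G p : F =1 G -> box_sum ds F p = box_sum ds G p.
Proof. by move=> /funext ->. Qed.

Lemma box_sumD ds F G p :
  box_sum ds (fun q => F q + G q) p = box_sum ds F p + box_sum ds G p.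
Proof.
by elim: ds p => [|d ds IH] p //=; rewrite -big_split; apply: eq_bigr => k _.
Qed.

Lemma box_sum_sum ds (D : {set I}) (F : I -> (I -> nat) -> 'F_2) p :
  box_sum ds (fun q => \sum_(d in D) F d q) p = \sum_(d in D) box_sum ds (F d) p.
Proof.
by elim: ds p => [|d ds IH] p //=; rewrite exchange_big; apply: eq_bigr => k _.
Qed.

Lemma box_sum_comm ds F (f : (I -> nat) -> I -> nat) p :
  (forall q d k, d \in ds -> f (set_at q d k) = set_at (f q) d k) ->
  box_sum ds (F \o f) p = box_sum ds F (f p).
Proof.
elim: ds p => [|d ds IH] p //= fC; apply: eq_bigr => k _.
rewrite IH ?fC ?mem_head // => q e j eds; by rewrite fC // inE eds orbT.
Qed.

Lemma box_sum_set_at ds F d k p : d \notin ds ->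
  box_sum ds (fun q => F (set_at q d k)) p = box_sum ds F (set_at p d k).
Proof.
move=> dds; apply: (@box_sum_comm ds F (fun q => set_at q d k)) => q f j fds.
apply/funext => i; rewrite /set_at; have [->|//] := eqVneq i d.
by case: eqVneq => // df; rewrite df fds in dds.
Qed.

Lemma box_sum_telescope ds d F p : uniq ds -> d \in ds ->
  box_sum ds (fun q => F (bump_at d q) + F q) p =
  box_sum (rem d ds) (fun q => F (set_at q d N) + F (set_at q d 0)) p.
Proof.
elim: ds p => [|e ds IH] p //= /andP[eds uds]; rewrite inE eq_sym.
have [<- _|ne /= dds] := eqVneq e d; last first.
  by apply: eq_bigr => k _; rewrite IH.
have comm_bump k : box_sum ds (fun q => F (bump_at e q)) (set_at p e k)
    = box_sum ds F (set_at p e k.+1).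
  rewrite (@box_sum_comm ds F (bump_at e)); last first.
    move=> q f j fds; apply/funext => i; rewrite /set_at /bump_at.
    case: (eqVneq i f) => [->|//]; case: eqVneq => [fe|]; last by rewrite addn0.
    by rewrite -fe fds in eds.
  congr box_sum; apply/funext => i; rewrite /set_at /bump_at.
  by case: eqVneq; rewrite ?addn1 ?addn0.
rewrite box_sumD !box_sum_set_at //.
under eq_bigr => k _ do rewrite box_sumD comm_bump.
elim: N => [|n IHn]; first by rewrite big_ord0 F2_addrr.
rewrite big_ord_recr /= IHn.
set a := box_sum _ _ _; set b := box_sum _ _ _; set c := box_sum _ _ _.
by rewrite [a + b]addrC addrACA F2_addrr addr0 addrC.
Qed.

Variable c : I -> (I -> nat) -> 'F_2.
Hypothesis N_gt0 : (0 < N)%N.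
Hypothesis c_lo : forall i p, p i = 0%N -> c i p = 0.
Hypothesis c_hi : forall i p, p i = N -> c i p = 1.

(** On a face of the grid orthogonal to e, the colouring of index e is constant,
    so every path in that face picks up a zero factor. *)
Lemma walk_sum_face l D p e : e \in l -> e \notin D ->
  p e = 0%N \/ p e = N -> walk_sum (map c l) D p = 0.
Proof.
move=> + eD; elim: l D p eD => [//|i l IH] D p eD; rewrite inE => eil pe /=.
apply: big1 => d dD.
have de : (e == d) = false by apply/eqP => ed; rewrite ed dD in eD.
have bpe : bump_at d p e = p e by rewrite /bump_at de addn0.
move: eil; have [<- _|_ /= el] := eqVneq e i; last first.
  by rewrite IH ?mulr0 ?bpe // !inE (negbTE eD) andbF.
have -> : c e (bump_at d p) = c e p.
  by case: pe => pe; [rewrite !c_lo|rewrite !c_hi]; rewrite ?bpe.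
by rewrite F2_addrr mul0r.
Qed.

(** Write the first factor as a coboundary: as the others form a cocycle, the
    product is the coboundary of the cochains g e below, and its sum telescopes
    to the boundary of the grid. There only the upper face orthogonal to the
    first direction contributes, and it carries the same sum in one dimension
    less. *)
Lemma box_walk_sum ds p : uniq ds ->
  box_sum ds (walk_sum (map c ds) [set d in ds]) p = 1.
Proof.
elim: ds p => [//|d ds IH] p uds.
set D := [set i in d :: ds].
pose g e q := c d q * walk_sum (map c ds) (D :\ e) q.
have DC e : e \notin D :\ e by rewrite !inE eqxx.
have gbump q : walk_sum (map c (d :: ds)) D q
    = \sum_(e in D) (g e (bump_at e q) + g e q).
  rewrite /=; under eq_bigr => e _ do rewrite mulrDl.
  rewrite !big_split /=; congr (_ + _).
  by rewrite -!mulr_sumr walk_sum_closed.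
have gface e q k : e \in D -> k = 0%N \/ k = N ->
    g e (set_at q e k) = if (e == d) && (k != 0%N) then
      walk_sum (map c ds) (D :\ d) (set_at q e k) else 0.
  move=> eD k0N; have qe : set_at q e k e = k by rewrite /set_at eqxx.
  have [ed|ned] /= := eqVneq e d; last first.
    rewrite /g (walk_sum_face (e := e)) ?mulr0 ?qe //.
    by move: eD; rewrite !inE (negbTE ned).
  rewrite /g ed in qe *; have [k0|kn0] := eqVneq k 0%N.
    by rewrite c_lo ?mul0r // qe k0.
  by case: k0N kn0 => [->//|kN _]; rewrite c_hi ?mul1r // qe.
have dD : d \in D by rewrite inE mem_head.
rewrite (eq_box_sum _ _ gbump) box_sum_sum (bigD1 d dD) -[RHS]addr0.
congr (_ + _); last first.
  apply: big1 => e /andP[eD /negbTE ned].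
  rewrite (box_sum_telescope (g e)) //; last first.
    by move: (eD : e \in D); rewrite inE.
  rewrite (@eq_box_sum _ _ (fun=> 0)) => [|q]; last first.
    by rewrite !gface ?ned ?addr0 //; [left|right].
  by elim: (rem e _) p => //= f s IHs q; rewrite big1.
rewrite (box_sum_telescope (g d)) ?mem_head //= eqxx.
have /andP[dds uds'] := uds.
rewrite (@eq_box_sum _ _ (fun q => walk_sum (map c ds) (D :\ d) (set_at q d N))).
  rewrite box_sum_set_at // -[RHS](IH (set_at p d N)) //; congr box_sum.
  congr walk_sum; apply/setP => i; rewrite !inE.
  by case: eqVneq => // ->; rewrite (negbTE dds).
move=> q; rewrite !gface; [|by [|left|right]..].
by rewrite eqxx /= -lt0n N_gt0 addr0.
Qed.

(** The last conjunct protects, through the induction, the coordinates already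
    chosen in the outer sums. *)
Lemma box_sum_neq0 ds F p : box_sum ds F p != 0 ->
  exists q, [/\ F q != 0, forall i, i \in ds -> (q i < N)%N &
                forall i, i \notin ds -> q i = p i].
Proof.
elim: ds p => [|d ds IH] p /=; first by exists p.
move=> nz; have [k] : exists k : 'I_N, box_sum ds F (set_at p d k) != 0.
  apply/existsP; apply: contraR nz => /existsPn nz.
  by apply/eqP/big1 => k _; apply/eqP/negPn/nz.
move=> /IH[q [Fq qlt qp]]; exists q; split=> // i; rewrite inE.
  case: (boolP (i \in ds)) => [/qlt //|/qp -> /orP[/eqP ->|//]].
  by rewrite /set_at eqxx.
by rewrite negb_or => /andP[/negbTE ne /qp ->]; rewrite /set_at ne.
Qed.

(** A nonzero sum has a path all of whose factors are nonzero: the colouring of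
    index i changes along the step of that path assigned to i. *)
Lemma walk_sum_neq0 l D q : walk_sum (map c l) D q != 0 ->
  forall i, i \in l -> exists r r',
    [/\ forall j, (q j <= r j <= q j + (j \in D))%N,
        forall j, (q j <= r' j <= q j + (j \in D))%N & c i r != c i r'].
Proof.
elim: l D q => [//|e l IH] D q /= nz i.
have [d dD] : exists2 d, d \in D &
    (c e (bump_at d q) + c e q) * walk_sum (map c l) (D :\ d) (bump_at d q) != 0.
  apply/exists_inP; apply: contraR nz => /exists_inPn nz.
  by apply/eqP/big1 => d /nz /negPn /eqP.
rewrite mulf_eq0 negb_or => /andP[ne nw].
have qd r : (forall j, (bump_at d q j <= r j <= bump_at d q j + (j \in D :\ d))%N) ->
    forall j, (q j <= r j <= q j + (j \in D))%N.
  move=> + j => /(_ j); rewrite /bump_at !inE.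
  by have [->|_] := eqVneq j d; rewrite ?dD /=; lia.
rewrite inE => /predU1P[->|il].
  exists (bump_at d q), q; split=> [||]; [|by move=> j; lia|].
    by apply: qd => j; lia.
  by apply: contraNneq ne => ->; rewrite F2_addrr.
have [r [r' [hr hr' crr]]] := IH _ _ nw i il.
by exists r, r'; split; [exact: qd|exact: qd|].
Qed.

(** The cubical counterpart of Sperner's lemma. *)
Lemma cell_all_colors : exists q : I -> nat, (forall i, (q i < N)%N) /\
  forall i, exists r r',
    [/\ forall j, (q j <= r j <= (q j).+1)%N,
        forall j, (q j <= r' j <= (q j).+1)%N & c i r != c i r'].
Proof.
have := box_walk_sum (fun=> 0%N) (enum_uniq I).
set W := box_sum _ _ _ => W1.
have /box_sum_neq0[q [Wq qN _]] : W != 0 by rewrite W1 oner_neq0.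
exists q; split=> [i|i]; first by apply: qN; rewrite mem_enum.
have ie : i \in enum I by rewrite mem_enum.
have [r [r' [hr hr' crr]]] := walk_sum_neq0 Wq ie.
by exists r, r'; split=> // j; [move: (hr j)|move: (hr' j)]; case: (j \in _); lia.
Qed.
End Cube.

(** * Approximate zeros of a map on a box *)

Definition in_box (R : realType) (I : Type) (lo hi x : I -> R) :=
  forall i, lo i <= x i <= hi i.

(** Colour a fine grid by the signs of the components of G, except on the
    boundary of the box, where the colour is forced; the sign conditions on the
    faces make the forced colours consistent with the weak inequalities used
    here. In a cell where all colours change, every component takes values of
    both signs, hence is small by uniform continuity. *)
Lemma poincare_miranda_approx (R : realType) (I : finType) (lo hi : I -> R)
    (G : (I -> R) -> I -> R) (eps : R) :
  (forall i, lo i <= hi i) -> 0 < eps ->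
  (exists2 del, 0 < del & forall x y, in_box lo hi x -> in_box lo hi y ->
     (forall i, `|x i - y i| <= del) -> forall i, `|G x i - G y i| <= eps) ->
  (forall x i, in_box lo hi x -> x i = lo i -> G x i <= 0) ->
  (forall x i, in_box lo hi x -> x i = hi i -> 0 <= G x i) ->
  exists2 x, in_box lo hi x & forall i, `|G x i| <= eps.
Proof.
move=> lohi eps0 [del del0 Gunif] Glo Ghi.
pose S := \sum_i (hi i - lo i).
pose N := (Num.bound (S / del)).+1.
have hS i : 0 <= hi i - lo i <= S.
  rewrite subr_ge0 lohi /S (bigD1 i) //= lerDl sumr_ge0 // => j _.
  by rewrite subr_ge0.
have S0 : 0 <= S by apply: sumr_ge0 => i _; rewrite subr_ge0.
have SN : S / N%:R <= del.
  rewrite ler_pdivrMr ?ltr0n // mulrC -ler_pdivrMr //.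
  have /archi_boundP/ltW Sb : 0 <= S / del by rewrite divr_ge0 // ltW.
  by apply: le_trans Sb _; rewrite ler_nat.
pose pt (q : I -> nat) i := lo i + (q i)%:R / N%:R * (hi i - lo i).
have ptbox q : (forall i, (q i <= N)%N) -> in_box lo hi (pt q).
  move=> qN i; have /andP[h0 _] := hS i; rewrite /pt lerDl mulr_ge0 ?divr_ge0 //=.
  rewrite -lerBrDl ler_piMl // ler_pdivrMr ?ltr0n // mul1r ler_nat //.
pose c i q : 'F_2 := ((q i != 0%N) && ((q i == N) || (0 < G (pt q) i)))%:R.
have c_lo i p : p i = 0%N -> c i p = 0 by rewrite /c => ->.
have c_hi i p : p i = N -> c i p = 1 by rewrite /c => ->; rewrite eqxx.
have [q [qN qc]] := cell_all_colors (isT : (0 < N)%N) c_lo c_hi.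
have qbox := ptbox q (fun i => ltnW (qN i)).
exists (pt q) => // i; have [r [r' [hr hr' crr]]] := qc i.
have near_q s : (forall j, (q j <= s j <= (q j).+1)%N) ->
    in_box lo hi (pt s) /\ `|G (pt q) i - G (pt s) i| <= eps.
  move=> hs; have sbox : in_box lo hi (pt s).
    by apply: ptbox => j; have := qN j; have := hs j; lia.
  split=> //; apply: Gunif => // j; have /andP[h0 hSj] := hS j.
  rewrite /pt opprD addrACA subrr add0r -mulrBl -mulrBl normrM (ger0_norm h0).
  rewrite normrM (@gtr0_norm _ N%:R^-1) ?invr_gt0 ?ltr0n //.
  apply: le_trans SN; rewrite mulrAC ler_pM2r ?invr_gt0 ?ltr0n //.
  apply: le_trans hSj; rewrite ler_piMl // distrC.
  by rewrite -natrB; [rewrite normr_nat lern1|]; have := hs j; lia.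
have low s : in_box lo hi (pt s) -> c i s = 0 -> G (pt s) i <= 0.
  move=> sbox; rewrite /c; have [s0 _|_] := eqVneq (s i) 0%N.
    by apply: Glo => //; rewrite /pt s0 mul0r mul0r addr0.
  by have [//|_ /=] := eqVneq (s i) N; case: ltP.
have high s : in_box lo hi (pt s) -> c i s != 0 -> 0 <= G (pt s) i.
  move=> sbox; rewrite /c; have [//|_] := eqVneq (s i) 0%N.
  have [sN _|_ /=] := eqVneq (s i) N; last by case: ltP => // /ltW.
  by apply: Ghi => //; rewrite /pt sN divff ?pnatr_eq0 // mul1r addrC subrK.
have [rbox rq] := near_q r hr; have [rbox' rq'] := near_q r' hr'.
have {low high} : (G (pt r) i <= 0 /\ 0 <= G (pt r') i) \/
                  (G (pt r') i <= 0 /\ 0 <= G (pt r) i).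
  have [cr|cr] := eqVneq (c i r) 0.
    by left; split; [exact: low|apply: high => //; rewrite -cr eq_sym].
  have cr' : c i r' = 0.
    by apply: contraNeq crr => /F2_neq01 ->; rewrite (F2_neq01 cr).
  by right; split; [exact: low|exact: high].
move: rq rq'; rewrite !ler_norml => /andP[? ?] /andP[? ?].
by case=> -[? ?]; apply/andP; split; lra.
Qed.

(** * Compactness and clamping *)

(** The point z' may leave K; difference quotients at the ends of a period use
    this. *)
Lemma compact_unif_continuous (R : realType) (V W : normedModType R)
    (f : V -> W) (K : set V) (eps : R) :
  compact K -> continuous f -> 0 < eps ->
  exists2 del, 0 < del & forall z z', K z -> `|z - z'| <= del ->
    `|f z - f z'| <= eps.
Proof.
move=> /compact_near_coveringP cK cf eps0.
have : \forall d \near (0 : R)^'+, K `<=` [set z | forall z', `|z - z'| <= d ->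
    `|f z - f z'| <= eps].
  apply: (cK _ _ (fun d z => forall z', `|z - z'| <= d -> `|f z - f z'| <= eps)).
  move=> z Kz; have e2 : 0 < eps / 2 by lra.
  have := cf z; move/cvgrPdist_le/(_ _ e2)/nbhs_normP => [r /= r0 hr].
  exists (ball z (r / 2), [set d | d < r / 2]).
    split; first by apply: nbhsx_ballx; lra.
    by apply: nbhs_right_lt; lra.
  move=> [y d] /= [yz dr] y' yy'.
  move: yz; rewrite -ball_normE /= => yz.
  have h1 : `|f z - f y| <= eps / 2 by apply: hr => /=; lra.
  have h2 : `|f z - f y'| <= eps / 2.
    by apply: hr => /=; have := ler_distD y z y'; lra.
  by have := ler_distD (f z) (f y) (f y'); rewrite (distrC (f y) (f z)); lra.
move=> hd; have [d [d0 hd']] := filter_ex (filterI (nbhs_right_gt 0) hd).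
by exists d => // z z' Kz; apply: hd'.
Qed.

Lemma compact_bounded_norm (R : realType) (V W : normedModType R)
    (f : V -> W) (K : set V) :
  compact K -> continuous f -> exists M, forall z, K z -> `|f z| <= M.
Proof.
move=> cK cf; have : compact (f @` K).
  by apply: continuous_compact => //; exact: continuous_subspaceT.
move=> /compact_bounded[M [_ /(_ (M + 1)) hM]]; exists (M + 1) => z Kz.
by apply: hM; [lra|exists z].
Qed.

(** The maximum of phi and psi is positive on K, hence bounded below there by a
    positive number. *)
Lemma compact_margin (R : realType) (V : topologicalType) (phi psi : V -> R)
    (K : set V) :
  compact K -> continuous phi -> continuous psi ->
  (forall z, K z -> phi z <= 0 -> 0 < psi z) ->
  \forall eta \near (0 : R)^'+, forall z, K z -> phi z <= eta -> eta <= psi z.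
Proof.
move=> cK cphi cpsi pos.
have [->|K0] := eqVneq K set0; first by near=> eta.
have [c Kc cmin] : exists2 c, c \in K &
    forall z, z \in K -> (phi \max psi) c <= (phi \max psi) z.
  apply: compact_EVT_min => //; first exact/set0P.
  apply: continuous_subspaceT => z; apply: continuous_max; [exact: cphi|].
  exact: cpsi.
rewrite inE in Kc.
have mu0 : 0 < (phi \max psi) c.
  rewrite /= lt_max; case: ltP => //= h; exact: pos.
near=> eta => z Kz phiz.
have eta_mu : eta < (phi \max psi) c by near: eta; exact: nbhs_right_lt.
have := cmin z (mem_set Kz); move: eta_mu => /= h1 h2.
have := lt_le_trans h1 h2; rewrite lt_max => /orP[|/ltW //].
by rewrite ltNge phiz.
Unshelve. all: by end_near. Qed.

Lemma coord_le_norm (R : realType) n (u : 'rV[R]_n) i : `|u 0 i| <= `|u|.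
Proof.
rewrite [leRHS]/Num.Def.normr /= mx_normrE.
by apply/bigmax_geP; right => /=; exists (0, i).
Qed.

Lemma norm_le_coord (R : realType) n (u : 'rV[R]_n) c : 0 <= c ->
  (forall i, `|u 0 i| <= c) -> `|u| <= c.
Proof.
move=> c0 hu; rewrite [leLHS]/Num.Def.normr /= mx_normrE.
by apply/bigmax_leP; split => // -[i j] _; rewrite (ord1 i) /=.
Qed.

Definition clamp (R : realDomainType) (N x : R) : R := Num.max (- N) (Num.min N x).

Lemma clamp_cases (R : realDomainType) (N x : R) : 0 <= N ->
  [\/ x <= - N /\ clamp N x = - N, N <= x /\ clamp N x = N |
      (- N <= x /\ x <= N) /\ clamp N x = x].
Proof.
move=> N0; rewrite /clamp; have [Nx|xN] := leP N x.
  by constructor 2; split => //; apply: max_r; lra.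
by have [Nx|xN'] := leP (- N) x; [constructor 3|constructor 1]; split; lra.
Qed.

Lemma clamp_bound (R : realDomainType) (N x : R) : 0 <= N -> `|clamp N x| <= N.
Proof.
by move=> N0; rewrite ler_norml; case: (clamp_cases x N0) => -[h ->]; lra.
Qed.

Lemma clamp_id (R : realDomainType) (N x : R) : `|x| <= N -> clamp N x = x.
Proof.
move=> xN; have N0 := le_trans (normr_ge0 x) xN.
by move: xN; rewrite ler_norml; case: (clamp_cases x N0) => -[h ->]; lra.
Qed.

Lemma clampN (R : realDomainType) (N x : R) : 0 <= N ->
  clamp N (- x) = - clamp N x.
Proof.
move=> N0; case: (clamp_cases x N0) => -[h ->];
  by case: (clamp_cases (- x) N0) => -[h' ->]; lra.
Qed.

Lemma clamp_lip (R : realDomainType) (N x y : R) : 0 <= N ->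
  `|clamp N x - clamp N y| <= `|x - y|.
Proof.
move=> N0; have := ler_norm (x - y); have := ler_norm (- (x - y)).
rewrite normrN => h1 h2; rewrite ler_norml.
case: (clamp_cases x N0) => -[h ->];
  by case: (clamp_cases y N0) => -[h' ->]; lra.
Qed.

Definition clamp_row (R : realDomainType) n (N : R) (w : 'rV[R]_n) : 'rV[R]_n :=
  \row_i clamp N (w 0 i).

Lemma clamp_row_lip (R : realType) n (N : R) (u u' : 'rV[R]_n) : 0 <= N ->
  `|clamp_row N u - clamp_row N u'| <= `|u - u'|.
Proof.
move=> N0; apply: norm_le_coord => // i; rewrite !mxE.
apply: le_trans (clamp_lip _ _ N0) _.
by have := coord_le_norm (u - u') i; rewrite !mxE.
Qed.

Lemma clamp_row_continuous (R : realType) n (N : R) : 0 <= N ->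
  continuous (clamp_row N : 'rV[R]_n -> 'rV[R]_n).
Proof.
move=> N0 u; apply/(@cvgrPdist_le _ _ _ _ (nbhs_filter u)) => eps eps0.
apply: filterS (nbhsx_ballx u eps eps0) => u'; rewrite -ball_normE => /ltW uu'.
by apply: le_trans uu'; exact: clamp_row_lip.
Qed.

Definition cube (R : realType) n (C : R) : set 'rV[R]_n :=
  [set u | forall i, `|u 0 i| <= C].

Lemma compact_cube (R : realType) n (C : R) : compact (@cube R n C).
Proof.
have -> : @cube R n C = [set u | forall i, `[- C, C]%classic (u 0 i)].
  by apply/seteqP; split=> u hu i; have := hu i; rewrite /= in_itv /= ler_norml.
by apply: (@rV_compact R n (fun=> `[- C, C]%classic)) => i; exact: segment_compact.
Qed.

Lemma compact_cylinder (R : realType) n (a b B C : R) :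
  compact (`[a, b] `*` @cube R n B `*` @cube R n C).
Proof.
apply: compact_setX; last exact: compact_cube.
by apply: compact_setX; [exact: segment_compact|exact: compact_cube].
Qed.

(** * Limits of grid functions *)

(** Restricting the hypothesis to the indices between a and b makes the lemma
    usable with bounds that hold only in a window. *)
Lemma increments_le (R : realType) (V : normedModType R) (f : int -> V) (c : R)
    (a b : int) : a <= b ->
  (forall k, a <= k < b -> `|f (k + 1) - f k| <= c) ->
  `|f b - f a| <= (b - a)%:~R * c.
Proof.
move=> ab; have [m ->] : exists m : nat, b = a + m%:Z by exists `|b - a|%N; lia.
elim: m => [|m IH] hf; first by rewrite addr0 !subrr normr0 mul0r.
have h1 := IH (fun k hk => hf k ltac:(lia)).
have h2 := hf (a + m%:Z) ltac:(lia).
have -> : a + m.+1%:Z = a + m%:Z + 1 by lia.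
apply: le_trans (ler_distD (f (a + m%:Z)) _ _) _.
have -> : a + m%:Z + 1 - a = (a + m%:Z - a) + 1 by lia.
by rewrite intrD mulrDl mul1r addrC lerD.
Qed.

Lemma grid_lipschitz (R : realType) (V : normedModType R) (f : int -> V) (h c : R) :
  0 < h -> (forall k, `|f (k + 1) - f k| <= h * c) ->
  forall k l : int, `|f k - f l| <= `|k%:~R * h - l%:~R * h| * c.
Proof.
move=> h0 hf; suff H k l : l <= k -> `|f k - f l| <= `|k%:~R * h - l%:~R * h| * c.
  move=> k l; have [/H //|/ltW/H] := leP l k.
  by rewrite distrC [X in _ <= X * _]distrC.
move=> lk; apply: le_trans (increments_le lk (fun i _ => hf i)) _.
rewrite -mulrBl -intrB normrM (gtr0_norm h0) ger0_norm ?mulrA // ler0z.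
by rewrite subr_ge0.
Qed.

(** Along an ultrafilter, a sequence in a compact set converges to any of its
    cluster points. Choosing limits in this way, separately at each time,
    dispenses with the extraction of subsequences. *)
Lemma ultra_compact_cvg (T : topologicalType) (U : set_system nat) (A : set T)
    (u : nat -> T) :
  UltraFilter U -> compact A -> (forall r, A (u r)) ->
  exists2 p, A p & u r @[r --> U] --> p.
Proof.
move=> UU cA uA; have [|p [Ap clp]] := cA (u @ U) _; first exact: nearW.
exists p => // B pB; have [//|UB] := in_ultra_setVsetC (u @^-1` B) UU.
by have [z [/= nBz /nBz]] := clp (~` B) B UB pB.
Qed.

Lemma is_derive_of_dist (R : realType) (V : normedModType R) (x : R -> V)
    (t : R) (d : V) :
  (forall eps, 0 < eps -> exists2 del, 0 < del & forall s, `|s - t| <= del ->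
     `|x s - x t - (s - t) *: d| <= eps * `|s - t|) ->
  is_derive t 1 x d.
Proof.
move=> hx; have cv : (s^-1 *: ((x \o shift t) (s *: (1 : R)) - x t))
    @[s --> (0 : R)^'] --> d.
  apply/cvgrPdist_le => eps /hx[del del0 hdel].
  near=> s.
  have s0 : s != 0 by near: s; exact: nbhs_dnbhs_neq.
  have sdel : `|s| <= del.
    near: s; apply: nbhs_dnbhs; exists del => //= s.
    by rewrite /ball_ /= sub0r normrN => /ltW.
  have := hdel (s + t); rewrite addrK => /(_ sdel) h.
  rewrite /= scaler1 distrC -[X in _ - X](scalerK s0) -scalerBr normrZ normfV.
  by rewrite mulrC ler_pdivrMr ?normr_gt0.
by apply: DeriveDef; [exact: (cvgP _ cv)|exact: cvg_lim].
Unshelve. all: by end_near. Qed.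

Lemma floor_dist (R : realType) (h t : R) : 0 < h ->
  `|(Num.floor (t / h))%:~R * h - t| <= h.
Proof.
move=> h0; have /andP[h1 h2] := floor_itv (t / h).
move: h1 h2; rewrite ler_pdivlMr // ltr_pdivrMr // intrD mulrDl mul1r => h1 h2.
by rewrite ler_norml; lra.
Qed.

Section LimitDerivative.
Variables (R : realType) (V : normedModType R) (U : set_system nat).
Context {PU : ProperFilter U}.
Variables (h : nat -> R) (u g : nat -> int -> V) (x w : R -> V).
Hypothesis h_gt0 : forall r, 0 < h r.
Hypothesis h_cvg : h r @[r --> U] --> 0.
Hypothesis u_cvg : forall s, u r (Num.floor (s / h r)) @[r --> U] --> x s.

Lemma floor_cvg s : (Num.floor (s / h r))%:~R * h r @[r --> U] --> s.
Proof.
apply/cvgrPdist_le => eps eps0; near=> r.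
rewrite distrC (le_trans (floor_dist _ (h_gt0 r))) //.
have : `|0 - h r| <= eps by near: r; move/cvgrPdist_le: h_cvg; exact.
by rewrite sub0r normrN => /(le_trans (ler_norm _)).
Unshelve. all: by end_near. Qed.

(** Passing to the limit in a difference equation. Near t the values of g r
    differ little from its value at the grid point of t, so that u r is affine
    up to an error proportional to the distance; this estimate survives the
    limit and characterizes the derivative of x. *)
Lemma limit_derivative t :
  g r (Num.floor (t / h r)) @[r --> U] --> w t ->
  (forall eps, 0 < eps -> exists2 del, 0 < del & \forall r \near U, forall k l,
     `|k%:~R * h r - t| <= del -> `|l%:~R * h r - t| <= del ->
     `|g r k - g r l| <= eps) ->
  (forall eps, 0 < eps -> \forall r \near U, forall k,
     `|u r (k + 1) - u r k - h r *: g r k| <= h r * eps) ->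
  is_derive t 1 x (w t).
Proof.
move=> g_cvg g_equi u_incr; apply: is_derive_of_dist => eps eps0.
have e2 : 0 < eps / 2 by lra.
have [del del0 hdel] := g_equi _ e2; exists (del / 2); first by lra.
move=> s sdel.
pose fl r a := Num.floor (a / h r).
have cvl : `|u r (fl r s) - u r (fl r t)
    - ((fl r s)%:~R * h r - (fl r t)%:~R * h r) *: g r (fl r t)| @[r --> U]
    --> `|x s - x t - (s - t) *: w t|.
  apply: cvg_norm; apply: cvgB; first by apply: cvgB; exact: u_cvg.
  by apply: cvgZ => //; apply: cvgB; exact: floor_cvg.
have cvr : eps * `|(fl r s)%:~R * h r - (fl r t)%:~R * h r| @[r --> U]
    --> eps * `|s - t|.
  by apply: cvgMr; apply: cvg_norm; apply: cvgB; exact: floor_cvg.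
apply: (ler_cvg_to cvl cvr); near=> r.
have hr0 := h_gt0 r.
have hrdel : h r <= del / 2.
  have : `|0 - h r| <= del / 2.
    by near: r; move/cvgrPdist_le: h_cvg; apply; lra.
  by rewrite sub0r normrN => /(le_trans (ler_norm _)).
have hg : forall k l, `|k%:~R * h r - t| <= del -> `|l%:~R * h r - t| <= del ->
    `|g r k - g r l| <= eps / 2 by near: r.
have hu : forall k, `|u r (k + 1) - u r k - h r *: g r k| <= h r * (eps / 2).
  by near: r; exact: u_incr.
set a := fl r t; set b := fl r s.
have ha : `|a%:~R * h r - t| <= del.
  by apply: le_trans (floor_dist _ hr0) _; lra.
have hb : `|b%:~R * h r - t| <= del.
  have := ler_distD s (b%:~R * h r) t; have := floor_dist s hr0.
  by rewrite -/(fl r s) -/b; lra.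
(* Subtracting the affine function with slope g r a leaves small increments,
   at most h r * eps each, on the window between a and b. *)
pose f k := u r k - (k%:~R * h r) *: g r a.
have hf k : `|k%:~R * h r - t| <= del -> `|f (k + 1) - f k| <= h r * eps.
  move=> hk; have -> : f (k + 1) - f k = (u r (k + 1) - u r k - h r *: g r k)
      + h r *: (g r k - g r a).
    rewrite /f intrD mulrDl mul1r scalerDl scalerBr !opprD !opprK !addrA subrK.
    by rewrite [LHS](ACl (1*4*5*2*3)) /= addrK.
  apply: le_trans (ler_normD _ _) _; rewrite normrZ (gtr0_norm hr0).
  have := hu k; have := hg k a hk ha; rewrite -(ler_pM2l hr0); lra.
have -> : u r b - u r a - (b%:~R * h r - a%:~R * h r) *: g r a = f b - f a.
  by rewrite /f scalerBl !opprB !addrA [LHS](ACl (1*4*3*2)).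
have seg k : a <= k <= b \/ b <= k <= a -> `|k%:~R * h r - t| <= del.
  move: ha hb; rewrite !ler_norml => /andP[? ?] /andP[? ?].
  have mono i j : (i <= j) -> i%:~R * h r <= j%:~R * h r.
    by move=> ij; rewrite ler_pM2r // ler_int.
  by case=> /andP[/mono ? /mono ?]; apply/andP; split; lra.
have [ab|/ltW ba] := leP a b.
  apply: le_trans (increments_le ab (c := h r * eps) _) _.
    by move=> k /andP[ak kb]; apply: hf; apply: seg; left; lia.
  rewrite -mulrBl -intrB normrM (gtr0_norm hr0) ger0_norm ?ler0z; last lia.
  by rewrite mulrC -mulrA mulrC -mulrA (mulrC eps); lra.
rewrite distrC; apply: le_trans (increments_le ba (c := h r * eps) _) _.
  by move=> k /andP[ak kb]; apply: hf; apply: seg; right; lia.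
rewrite distrC -mulrBl -intrB normrM (gtr0_norm hr0) ger0_norm ?ler0z; last lia.
by lra.
Unshelve. all: by end_near. Qed.
End LimitDerivative.

(** * Difference quotients and Landau's inequality *)

Definition C2 (R : realType) (g g1 g2 : R -> R) :=
  [/\ continuous g, forall t : R, is_derive t 1 g (g1 t),
      continuous g1, forall t : R, is_derive t 1 g1 (g2 t) & continuous g2].

Lemma smooth_C2 (R : realType) (g : R -> R) : smooth g -> C2 g g^`() g^`(2).
Proof.
have E (f : R -> R) : 'D_1 f = f^`() by apply/funext => t; rewrite derive1E.
move=> /(_ 2)[cg /(_ 1)[dg [cg1 /(_ 1)[dg1 cg2]]]].
move: cg1 dg1 cg2; rewrite E => cg1 dg1; rewrite E => cg2; split.
- exact: cg.
- by move=> t; apply: DeriveDef; [exact: dg|rewrite derive1E].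
- exact: cg1.
- by move=> t; apply: DeriveDef; [exact: dg1|rewrite -derive1E].
- exact: cg2.
Qed.

Lemma MVT_everywhere (R : realType) (f df : R -> R) (a b : R) :
  (forall s : R, is_derive s 1 f (df s)) -> a < b ->
  exists2 c, a < c < b & f b - f a = df c * (b - a).
Proof.
move=> dfP ab; have cf : {within `[a, b], continuous f}.
  by apply: derivable_within_continuous => s _; exact: (@ex_derive _ _ _ _ _ _ _ (dfP s)).
have [c cab fE] := MVT ab (fun s _ => dfP s) cf.
by exists c => //; move: cab; rewrite in_itv.
Qed.

(** On an interval of length N / (2 K) the mean value of f1 is at most N / 2 in
    absolute value since f is bounded by B, and f1 varies there by at most N / 2
    since its derivative is bounded by K. *)
Lemma landau_inequality (R : realType) (f f1 f2 : R -> R) (B K N : R) :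
  (forall t : R, is_derive t 1 f (f1 t)) -> (forall t : R, is_derive t 1 f1 (f2 t)) ->
  (forall t, `|f t| <= B) -> (forall t, `|f2 t| <= K) ->
  0 < K -> 0 < N -> 8 * B * K <= N ^+ 2 -> forall t, `|f1 t| <= N.
Proof.
move=> df df1 fB f2K K0 N0 BKN t; pose s := N / (2 * K).
have s0 : 0 < s by rewrite divr_gt0 ?mulr_gt0.
have sK : 2 * (s * K) = N by rewrite /s; field; rewrite gt_eqF.
have [|c /andP[c1 c2] fc] := MVT_everywhere (a := t) (b := t + s) df; first lra.
have [c' _ f1c] := MVT_everywhere df1 c1.
have h1 : `|f1 c - f1 t| <= s * K.
  rewrite f1c normrM mulrC ler_pM ?normr_ge0 //.
  by rewrite gtr0_norm ?subr_gt0 //; lra.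
have h2 : `|f1 c| <= 2 * B / s.
  rewrite ler_pdivlMr // -{1}(gtr0_norm s0) -normrM.
  have -> : f1 c * s = f (t + s) - f t by rewrite fc addrAC subrr add0r.
  by apply: le_trans (ler_normB _ _) _; have := fB t; have := fB (t + s); lra.
have h3 : 2 * B / s <= s * K.
  rewrite ler_pdivrMr // -(ler_pM2l (_ : 0 < 4 * K)) ?mulr_gt0 //.
  have -> : 4 * K * (s * K * s) = (2 * (s * K)) ^+ 2 by ring.
  by rewrite sK; lra.
have := ler_normB (f1 c) (f1 c - f1 t); rewrite opprB addrC subrK; lra.
Qed.

Lemma is_derive_coord (R : realType) n (x : R -> 'rV[R]_n) (t : R) d j :
  is_derive t 1 x d -> is_derive t 1 (fun s => x s 0 j) (d 0 j).
Proof.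
move=> [dx xE]; apply: DeriveDef; first exact: (derivable_mxP x t 1).1.
by rewrite -xE derive_mx // mxE.
Qed.

(** Both estimates are uniform in t because g1 and g2 are uniformly continuous
    near [0, T]. The velocity quotient is backward, as in the scheme below. *)
Lemma difference_quotients (R : realType) (g g1 g2 : R -> R) (T eps : R) :
  C2 g g1 g2 -> 0 < eps ->
  \forall h \near (0 : R)^'+, forall t, 0 <= t <= T ->
    `|g t - g (t - h) - h * g1 t| <= h * eps /\
    `|g (t + h) - 2 * g t + g (t - h) - h ^+ 2 * g2 t| <= h ^+ 2 * eps.
Proof.
case=> _ dg cg1 dg1 cg2 eps0.
have cK := @segment_compact R 0 T.
have [d1 d10 h1] := compact_unif_continuous cK cg1 eps0.
have [d2 d20 h2] := compact_unif_continuous cK cg2 eps0.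
near=> h => t tT; have tK : `[0, T]%classic t by rewrite /= in_itv.
have h0 : 0 < h by near: h; exact: nbhs_right_gt.
have hd1 : h <= d1 by near: h; exact: nbhs_right_le.
have hd2 : h <= d2 by near: h; exact: nbhs_right_le.
split.
  have [|c /andP[c1 c2] ->] := MVT_everywhere (a := t - h) (b := t) dg; first lra.
  have -> : g1 c * (t - (t - h)) - h * g1 t = h * (g1 c - g1 t) by lra.
  rewrite normrM (gtr0_norm h0) ler_pM2l // distrC; apply: h1 => //.
  by rewrite ler_norml; lra.
have dk (s : R) : is_derive s 1 (fun s => g (s + h) - g s) (g1 (s + h) - g1 s).
  have dgs := dg (s + h); have dgs' := dg s.
  have dsh : is_derive s 1 (g \o (fun s => s + h)) (g1 (s + h)).
    rewrite -[g1 _]mulr1; apply: is_derive1_comp; first exact: dg.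
    exact: is_derive_shift.
  exact: is_deriveB.
have [|c /andP[c1 c2]] := MVT_everywhere (a := t - h) (b := t) dk; first lra.
have [|c' /andP[c1' c2']] := MVT_everywhere (a := c) (b := c + h) dg1; first lra.
have -> : t - h + h = t by lra. have -> : t - (t - h) = h by lra.
have -> : c + h - c = h by lra. move=> -> E.
have -> : g (t + h) - 2 * g t + g (t - h) - h ^+ 2 * g2 t = h ^+ 2 * (g2 c' - g2 t).
  have -> : g (t + h) - 2 * g t + g (t - h) = g2 c' * h * h by rewrite -E; lra.
  by ring.
rewrite normrM ger0_norm ?sqr_ge0 // ler_wpM2l ?sqr_ge0 // distrC; apply: h2 => //.
by rewrite ler_norml; lra.
Unshelve. all: by end_near. Qed.

(** * The tube between the bounding functions *)

Lemma periodicz (R : realType) (V : zmodType) (f : R -> V) (T : R) (q : int) t :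
  periodic f T -> f (t + T *~ q) = f t.
Proof.
move=> fT; case: q => m; first exact: periodicn.
rewrite NegzE mulrNz -[in RHS](subrK (T *~ m.+1) t).
exact: (esym (periodicn fT m.+1 _)).
Qed.

Lemma period_shift (R : realType) (T t : R) : 0 < T ->
  exists q : int, 0 <= t + T *~ q <= T.
Proof.
move=> T0; exists (- Num.floor (t / T)); rewrite mulrNz -mulrzl.
have /andP[h1 h2] := floor_itv (t / T).
by move: h1 h2; rewrite ler_pdivlMr // ltr_pdivrMr // intrD mulrDl mul1r; lra.
Qed.

Lemma family_bounded (R : realType) n (f : 'I_n -> R -> R) (T : R) :
  (forall j, continuous (f j)) ->
  exists M, forall j t, 0 <= t <= T -> `|f j t| <= M.
Proof.
move=> cf; have /choice[M hM] j :=
  compact_bounded_norm (@segment_compact R 0 T) (cf j).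
exists (\sum_j `|M j|) => j t tT; apply: le_trans (hM j t _) _.
  by rewrite /= in_itv.
by rewrite (le_trans (ler_norm _)) // (bigD1 j) //= lerDl sumr_ge0.
Qed.

Lemma norm_between (R : realDomainType) (lo x hi a b : R) :
  lo <= x <= hi -> `|lo| <= a -> `|hi| <= b -> `|x| <= a + b.
Proof. by rewrite !ler_norml; lra. Qed.

Lemma between_shrink (R : realDomainType) (lo x hi e : R) :
  0 < e -> lo + e <= x <= hi - e -> lo <= x <= hi.
Proof. by lra. Qed.

Lemma norm_difference_le (R : realFieldType) (x x' y y' e : R) :
  `|x - x'| <= e / 2 -> `|y - y'| <= e / 2 -> `|(x - y) - (x' - y')| <= e.
Proof. by rewrite !ler_norml; lra. Qed.

(** Stability of the residual of the scheme with respect to its unknowns. *)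
Lemma norm_residual_le (R : realFieldType) (f f' a a' b b' c c' e : R) :
  `|f - f'| <= e / 2 -> `|a - a'| <= e / 8 -> `|b - b'| <= e / 8 ->
  `|c - c'| <= e / 8 ->
  `|f - (a - 2 * b + c) - (f' - (a' - 2 * b' + c'))| <= e.
Proof. by rewrite !ler_norml; lra. Qed.

Lemma div2D (R : realFieldType) (e c : R) : 0 < c -> e / (2 * c) + e / (2 * c) = e / c.
Proof. by move=> c0; field; rewrite gt_eqF. Qed.

Section PhaseSpace.
Variables (R : realType) (n : nat).
Let E := (R * 'rV[R]_n * 'rV[R]_n)%type.

Lemma continuous_time (g : R -> R) : continuous g ->
  continuous (fun z : E => g z.1.1).
Proof.
move=> cg z; apply: (@continuous_comp _ _ _ (fun z : E => z.1.1) g); last exact: cg.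
by apply: (@continuous_comp _ _ _ fst fst); exact: cvg_fst.
Qed.

Lemma continuous_position i : continuous (fun z : E => z.1.2 0 i).
Proof.
move=> z; apply: (@continuous_comp _ _ _ (fun z : E => z.1.2) (fun u => u 0 i)).
  by apply: (@continuous_comp _ _ _ fst snd); [exact: cvg_fst|exact: cvg_snd].
exact: coord_continuous.
Qed.

Lemma continuous_velocity i : continuous (fun z : E => z.2 0 i).
Proof.
move=> z; apply: (@continuous_comp _ _ _ (fun z : E => z.2) (fun u => u 0 i)).
  exact: cvg_snd.
exact: coord_continuous.
Qed.

(** The positions lie between the bounding functions and the velocities in a
    cube: the set on which the assumptions on v are used. *)
Lemma compact_tube (T N : R) (lo hi : 'I_n -> R -> R) :
  (forall j, continuous (lo j)) -> (forall j, continuous (hi j)) ->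
  compact [set z : E | [/\ 0 <= z.1.1 <= T,
    forall i, lo i z.1.1 <= z.1.2 0 i <= hi i z.1.1 & forall i, `|z.2 0 i| <= N]].
Proof.
move=> clo chi.
have [M1 hM1] := family_bounded T clo; have [M2 hM2] := family_bounded T chi.
set K := [set _ | _]; pose M := M1 + M2.
have -> : K = (`[0, T] `*` @cube R n M `*` @cube R n N) `&`
   \bigcap_(i in [set: 'I_n]) ([set z : E | lo i z.1.1 - z.1.2 0 i <= 0] `&`
                             [set z : E | z.1.2 0 i - hi i z.1.1 <= 0]).
  apply/seteqP; split=> [[[t y] w] [/= tT yb wN]|[[t y] w] [[[/= tT _] wN] yb]].
    split; last by move=> i _ /=; have := yb i; split; lra.
    split=> //; split; first by rewrite /= in_itv.
    by move=> i; exact: norm_between (yb i) (hM1 i t tT) (hM2 i t tT).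
  rewrite in_itv /= in tT; split=> //.
  by move=> i; have [/=] := yb i I; lra.
apply: compact_closedI; first exact: compact_cylinder.
apply: closed_bigI => i _; apply: closedI.
  apply: (@preimage_closed _ _ (fun z : E => lo i z.1.1 - z.1.2 0 i) [set x | x <= 0]);
    last exact: closed_le.
  move=> z _; apply: cvgB; first exact: continuous_time.
  exact: continuous_position.
apply: (@preimage_closed _ _ (fun z : E => z.1.2 0 i - hi i z.1.1) [set x | x <= 0]);
  last exact: closed_le.
move=> z _; apply: cvgB; first exact: continuous_position.
exact: continuous_time.
Qed.
End PhaseSpace.

(** The sign of the residual on a lower face. The numbers pm, p0, p stand for
    the lower function at three consecutive grid points, q and q2 for its first
    two derivatives, c, b, a for the values of the unknown, and f for the force.
    As c lies above pm + eta and b equals p0 + eta, the velocity (b - c) / h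
    cannot exceed q by much. If it is close to q, the margin in the bound on f
    absorbs the discretization error. If it is much below q, then c is above
    pm + eta by at least a multiple of h, which dominates the terms of order
    h ^ 2. *)
Lemma face_estimate (R : realType) (h eta N K K2 : R) (p pm p0 q q2 a b c f : R) :
  0 < h -> 0 < eta -> `|q| <= N ->
  `|p0 - pm - h * q| <= h * (eta / 2) ->
  `|p - 2 * p0 + pm - h ^+ 2 * q2| <= h ^+ 2 * (eta / 2) ->
  p + eta <= a -> b = p0 + eta -> pm + eta <= c ->
  (`|clamp N (h^-1 * (b - c)) - q| <= eta -> f <= q2 - eta) ->
  `|f| <= K -> `|q2| <= K2 -> h * (2 * (K + K2 + eta)) <= eta ->
  h ^+ 2 * f <= a - 2 * b + c.
Proof.
move=> h0 eta0 qN hq hq2 pa bp pc hf fK qK hsmall.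
have N0 := le_trans (normr_ge0 q) qN.
set w := h^-1 * (b - c) in hf *.
have bc : b - c = h * w by rewrite /w mulVKf ?gt_eqF.
move: hq hq2 fK qK qN; rewrite !ler_norml.
move=> /andP[hq_1 hq_2] /andP[hq2_1 hq2_2] /andP[fK1 fK2] /andP[qK1 qK2] /andP[qN1 qN2].
have wq : w <= q + eta / 2 by rewrite -(ler_pM2l h0) -bc; lra.
have hh0 : 0 < h ^+ 2 by rewrite exprn_gt0.
have [near_q|] := boolP (`|clamp N w - q| <= eta).
  have := hf near_q; rewrite -(ler_pM2l hh0); lra.
rewrite -ltNge => far_q; have {far_q} wq' : w < q - eta.
  by move: far_q; rewrite ltr_normr; case: (clamp_cases w N0) => -[? ->] /orP[]; lra.
have hw : h * w < h * (q - eta) by rewrite ltr_pM2l.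
have hb : h ^+ 2 * (f - q2 + eta / 2) <= h ^+ 2 * (K + K2 + eta).
  by rewrite ler_pM2l //; lra.
have hb2 : h ^+ 2 * (K + K2 + eta) <= h * (eta / 2).
  by rewrite expr2 -mulrA ler_pM2l //; lra.
lra.
Qed.

(** Obtained from the lower case by changing all signs. *)
Lemma face_estimate_upper (R : realType) (h eta N K K2 : R)
    (p pm p0 q q2 a b c f : R) :
  0 < h -> 0 < eta -> `|q| <= N ->
  `|p0 - pm - h * q| <= h * (eta / 2) ->
  `|p - 2 * p0 + pm - h ^+ 2 * q2| <= h ^+ 2 * (eta / 2) ->
  a <= p - eta -> b = p0 - eta -> c <= pm - eta ->
  (`|clamp N (h^-1 * (b - c)) - q| <= eta -> q2 + eta <= f) ->
  `|f| <= K -> `|q2| <= K2 -> h * (2 * (K + K2 + eta)) <= eta ->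
  a - 2 * b + c <= h ^+ 2 * f.
Proof.
move=> h0 eta0 qN hq hq2 pa bp pc hf fK qK hsmall.
have N0 := le_trans (normr_ge0 q) qN.
suff : h ^+ 2 * - f <= - a - 2 * - b + - c by lra.
apply: (@face_estimate _ h eta N K K2 (- p) (- pm) (- p0) (- q) (- q2));
  rewrite ?normrN //; try lra.
- by rewrite (_ : _ - _ = - (p0 - pm - h * q)) ?normrN //; ring.
- by rewrite (_ : _ - _ = - (p - 2 * p0 + pm - h ^+ 2 * q2)) ?normrN //; ring.
rewrite -opprD mulrN clampN // -opprD normrN => /hf; lra.
Qed.

(** Reduction of an integer modulo the number of grid points, with values in the
    finite type that indexes the unknowns. *)
Lemma grid_index (m : nat) : exists idx : int -> 'I_m.+1,
  [/\ forall k q : int, idx (k + q * m.+1%:Z) = idx k,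
      forall k, exists q : int, k = (idx k)%:Z + q * m.+1%:Z &
      forall i : 'I_m.+1, idx i%:Z = i].
Proof.
have m0 : m.+1%:Z != 0 by [].
exists (fun k => inord `|(k %% m.+1)%Z|%N); split.
- by move=> k q; rewrite addrC modzMDl.
- move=> k; exists (k %/ m.+1)%Z; rewrite addrC inordK; last first.
    by have := ltz_mod k m0; have := modz_ge0 k m0; lia.
  by rewrite gez0_abs ?modz_ge0 // -divz_eq.
- by move=> i; rewrite modz_small ?ltz_nat ?ltn_ord //= inord_val.
Qed.

(** * The difference scheme *)

Section DifferenceScheme.
Variables (R : realType) (T : R) (n : nat).
Variables (v : R * 'rV[R]_n * 'rV[R]_n -> 'rV[R]_n).
Variables (x1 dx1 ddx1 x2 dx2 ddx2 : 'I_n -> R -> R) (N K : R).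
Hypothesis T_gt0 : 0 < T.
Hypothesis v_continuous : continuous v.
Hypothesis v_periodic : forall y w : 'rV[R]_n, periodic (fun t : R => v (t, y, w)) T.
Hypothesis x1_C2 : forall j, C2 (x1 j) (dx1 j) (ddx1 j).
Hypothesis x2_C2 : forall j, C2 (x2 j) (dx2 j) (ddx2 j).
Hypothesis x1_periodic : forall j : 'I_n, periodic (x1 j) T.
Hypothesis x2_periodic : forall j : 'I_n, periodic (x2 j) T.
Hypothesis x1_lt_x2 : forall (t : R) (j : 'I_n), x1 j t < x2 j t.
Hypothesis x1_lower : forall (t : R) (j : 'I_n) (y w : 'rV[R]_n),
  y 0 j = x1 j t -> w 0 j = dx1 j t ->
  (forall i : 'I_n, i != j -> x1 i t <= y 0 i <= x2 i t) ->
  ddx1 j t > v (t, y, w) 0 j.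
Hypothesis x2_upper : forall (t : R) (j : 'I_n) (y w : 'rV[R]_n),
  y 0 j = x2 j t -> w 0 j = dx2 j t ->
  (forall i : 'I_n, i != j -> x1 i t <= y 0 i <= x2 i t) ->
  ddx2 j t < v (t, y, w) 0 j.

Definition in_tube (t : R) (y : 'rV[R]_n) := forall i, x1 i t <= y 0 i <= x2 i t.

(** The strict inequalities assumed on the bounding functions, in a form that
    survives discretization: they hold with margin eta, at positions and
    velocities that coincide with those of the bounding function only up to
    eta. *)
Definition uniform_margin (eta : R) := forall (j : 'I_n) (t : R),
  0 <= t <= T -> x1 j t + eta <= x2 j t - eta /\
  forall y w : 'rV[R]_n, in_tube t y -> (forall i, `|w 0 i| <= N) ->
    (`|y 0 j - x1 j t| <= eta -> `|w 0 j - dx1 j t| <= eta ->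
       v (t, y, w) 0 j <= ddx1 j t - eta) /\
    (`|y 0 j - x2 j t| <= eta -> `|w 0 j - dx2 j t| <= eta ->
       ddx2 j t + eta <= v (t, y, w) 0 j).

(** Three applications of compact_margin for each coordinate: on [0, T], and on
    the tube with the distance to the position and velocity of either bounding
    function. *)
Lemma face_margin : \forall eta \near (0 : R)^'+, uniform_margin eta.
Proof.
apply: filter_forall => j.
have [c1 _ c1' _ c1''] := x1_C2 j.
have [c2 _ c2' _ c2''] := x2_C2 j.
have cv : continuous (fun z => v z 0 j).
  move=> z; apply: (@continuous_comp _ _ _ v (fun u => u 0 j)).
    exact: v_continuous.
  exact: coord_continuous.
have ctube := @compact_tube R n T N x1 x2
  (fun j => let: And5 c _ _ _ _ := x1_C2 j in c)
  (fun j => let: And5 c _ _ _ _ := x2_C2 j in c).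
pose E := (R * 'rV[R]_n * 'rV[R]_n)%type.
have cdist (g g1 : R -> R) : continuous g -> continuous g1 -> continuous
    ((fun z : E => `|z.1.2 0 j - g z.1.1|) \max (fun z : E => `|z.2 0 j - g1 z.1.1|)).
  move=> cg cg1 z; apply: continuous_max; apply: cvg_norm; apply: cvgB.
  - exact: continuous_position.
  - exact: continuous_time.
  - exact: continuous_velocity.
  - exact: continuous_time.
have m1 := compact_margin ctube (cdist _ _ c1 c1')
  (psi := fun z : E => ddx1 j z.1.1 - v z 0 j).
have m2 := compact_margin ctube (cdist _ _ c2 c2')
  (psi := fun z : E => v z 0 j - ddx2 j z.1.1).
have m0 : \forall eta \near (0 : R)^'+, forall t, `[0, T]%classic t ->
    0 <= eta -> eta <= (x2 j t - x1 j t) / 2.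
  apply: (@compact_margin R R (fun=> 0) _ `[0, T] (@segment_compact R 0 T))
    => [s|s|s _ _]; first exact: cvg_cst.
    by apply: cvgMl; apply: cvgB; [exact: c2|exact: c1].
  by have := x1_lt_x2 s j; lra.
near=> eta => t tT; split.
  have : eta <= (x2 j t - x1 j t) / 2.
    have h : forall t, `[0, T]%classic t -> 0 <= eta -> eta <= (x2 j t - x1 j t) / 2.
      by near: eta.
    by apply: h; [rewrite /= in_itv|near: eta; exact: nbhs_right_ge].
  lra.
move=> y w yt wN.
have zt : [/\ 0 <= t <= T, in_tube t y & forall i, `|w 0 i| <= N] by [].
split=> hy hw.
  rewrite lerBrDl -lerBrDr.
  suff h : forall z : E, [/\ 0 <= z.1.1 <= T, in_tube z.1.1 z.1.2 &
      forall i, `|z.2 0 i| <= N] -> Num.max `|z.1.2 0 j - x1 j z.1.1|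
      `|z.2 0 j - dx1 j z.1.1| <= eta -> eta <= ddx1 j z.1.1 - v z 0 j.
    by apply: (h (t, y, w)) => //=; rewrite ge_max hy.
  near: eta; apply: m1.
    by move=> z; apply: cvgB; [exact: continuous_time|exact: cv].
  move=> [[s z] u] [/= sT zs uN].
  rewrite ge_max !normr_le0 !subr_eq0 => /andP[/eqP zj /eqP uj].
  by rewrite subr_gt0; apply: x1_lower => // i _; exact: zs.
rewrite -lerBrDl.
suff h : forall z : E, [/\ 0 <= z.1.1 <= T, in_tube z.1.1 z.1.2 &
    forall i, `|z.2 0 i| <= N] -> Num.max `|z.1.2 0 j - x2 j z.1.1|
    `|z.2 0 j - dx2 j z.1.1| <= eta -> eta <= v z 0 j - ddx2 j z.1.1.
  by apply: (h (t, y, w)) => //=; rewrite ge_max hy.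
near: eta; apply: m2.
  by move=> z; apply: cvgB; [exact: cv|exact: continuous_time].
move=> [[s z] u] [/= sT zs uN].
rewrite ge_max !normr_le0 !subr_eq0 => /andP[/eqP zj /eqP uj].
by rewrite subr_gt0; apply: x2_upper => // i _; exact: zs.
Unshelve. all: by end_near. Qed.

Hypothesis N_ge0 : 0 <= N.
Hypothesis K_ge0 : 0 <= K.
Hypothesis dx1_le : forall j t, 0 <= t <= T -> `|dx1 j t| <= N.
Hypothesis dx2_le : forall j t, 0 <= t <= T -> `|dx2 j t| <= N.
Hypothesis v_le : forall t (y w : 'rV[R]_n), 0 <= t <= T -> in_tube t y ->
  (forall i, `|w 0 i| <= N) -> forall j, `|v (t, y, w) 0 j| <= K.

(** With backward differences, the increment of the discrete velocity from k to
    k + 1 is the second difference at k divided by h, so that the scheme reads as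
    a first order recurrence for the velocity with no shift of index. *)
Definition backward (h : R) (Y : int -> 'rV[R]_n) (k : int) : 'rV[R]_n :=
  h^-1 *: (Y k - Y (k - 1)).

Definition second_difference (Y : int -> 'rV[R]_n) (k : int) : 'rV[R]_n :=
  Y (k + 1) - 2 *: Y k + Y (k - 1).

Definition force (h : R) (Y : int -> 'rV[R]_n) (k : int) : 'rV[R]_n :=
  v (k%:~R * h, Y k, clamp_row N (backward h Y k)).

(** The distance eta to the bounding functions is what yields strict inequalities
    in the limit. *)
Definition between (h eta : R) (Y : int -> 'rV[R]_n) :=
  forall k j, x1 j (k%:~R * h) + eta <= Y k 0 j <= x2 j (k%:~R * h) - eta.

(** The sign conditions of the Poincare-Miranda theorem on the faces of the box
    that between describes. *)
Definition inward (eta h : R) := forall Y, between h eta Y ->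
  forall (k : int) j, 0 <= k%:~R * h <= T ->
  (Y k 0 j = x1 j (k%:~R * h) + eta ->
     h ^+ 2 * force h Y k 0 j <= second_difference Y k 0 j) /\
  (Y k 0 j = x2 j (k%:~R * h) - eta ->
     second_difference Y k 0 j <= h ^+ 2 * force h Y k 0 j).

Lemma face_signs : \forall eta \near (0 : R)^'+, \forall h \near (0 : R)^'+,
  inward eta h.
Proof.
have [K2 hK2] : exists K2, forall j t, 0 <= t <= T ->
    `|ddx1 j t| <= K2 /\ `|ddx2 j t| <= K2.
  have [M1 hM1] := family_bounded T (fun j => let: And5 _ _ _ _ c := x1_C2 j in c).
  have [M2 hM2] := family_bounded T (fun j => let: And5 _ _ _ _ c := x2_C2 j in c).
  exists (`|M1| + `|M2|) => j t tT; split.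
    by apply: le_trans (hM1 j t tT) _; rewrite (le_trans (ler_norm _)) // lerDl.
  by apply: le_trans (hM2 j t tT) _; rewrite (le_trans (ler_norm _)) // lerDr.
near=> eta.
have eta0 : 0 < eta by near: eta; exact: nbhs_right_gt.
have margin : uniform_margin eta by near: eta; exact: face_margin.
have e2 : 0 < eta / 2 by lra.
near=> h.
have h0 : 0 < h by near: h; exact: nbhs_right_gt.
have dq1 : forall j t, 0 <= t <= T ->
    `|x1 j t - x1 j (t - h) - h * dx1 j t| <= h * (eta / 2) /\
    `|x1 j (t + h) - 2 * x1 j t + x1 j (t - h) - h ^+ 2 * ddx1 j t|
      <= h ^+ 2 * (eta / 2).
  near: h; apply: filter_forall => j; exact: difference_quotients (x1_C2 j) e2.
have dq2 : forall j t, 0 <= t <= T ->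
    `|x2 j t - x2 j (t - h) - h * dx2 j t| <= h * (eta / 2) /\
    `|x2 j (t + h) - 2 * x2 j t + x2 j (t - h) - h ^+ 2 * ddx2 j t|
      <= h ^+ 2 * (eta / 2).
  near: h; apply: filter_forall => j; exact: difference_quotients (x2_C2 j) e2.
have hsmall : h * (2 * (K + K2 + eta)) <= eta.
  have hC : h <= eta / (2 * (`|K| + `|K2| + eta)).
    near: h; apply: nbhs_right_le; rewrite divr_gt0 //.
    have := normr_ge0 K; have := normr_ge0 K2; lra.
  have C0 : 0 < 2 * (`|K| + `|K2| + eta).
    have := normr_ge0 K; have := normr_ge0 K2; lra.
  move: hC; rewrite ler_pdivlMr // => hC; apply: le_trans hC.
  by rewrite ler_pM2l //; have := ler_norm K; have := ler_norm K2; lra.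
move=> Y hY k j; set t := k%:~R * h => tT.
have tp : (k + 1)%:~R * h = t + h by rewrite intrD mulrDl mul1r.
have tm : (k - 1)%:~R * h = t - h by rewrite intrB mulrBl mul1r.
have Yt : in_tube t (Y k).
  by move=> i; have := hY k i; rewrite -/t; lra.
pose Q := clamp_row N (backward h Y k).
have QN i : `|Q 0 i| <= N by rewrite mxE; exact: clamp_bound.
have [_ /(_ _ _ Yt QN)[m1 m2]] := margin j t tT.
have [dq1a dq1b] := dq1 j t tT; have [dq2a dq2b] := dq2 j t tT.
have [K21 K22] := hK2 j t tT.
have Kf := v_le tT Yt QN j.
have := hY (k + 1) j; have := hY (k - 1) j; rewrite tp tm => hm hp.
have sdE : second_difference Y k 0 j = Y (k + 1) 0 j - 2 * Y k 0 j + Y (k - 1) 0 j.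
  by rewrite /second_difference !mxE.
have QE : Q 0 j = clamp N (h^-1 * (Y k 0 j - Y (k - 1) 0 j)).
  by rewrite /Q /backward !mxE.
have /andP[hp1 hp2] := hp; have /andP[hm1 hm2] := hm.
rewrite sdE; split=> Yk.
  apply: (face_estimate h0 eta0 (dx1_le j tT) dq1a dq1b hp1 Yk hm1 _ Kf K21 hsmall).
  by rewrite -QE; apply: m1; rewrite Yk addrAC subrr add0r gtr0_norm.
apply: (face_estimate_upper h0 eta0 (dx2_le j tT) dq2a dq2b hp2 Yk hm2 _ Kf K22 hsmall).
by rewrite -QE; apply: m2; rewrite Yk addrAC subrr add0r normrN gtr0_norm.
Unshelve. all: by end_near. Qed.

Lemma tube_shift t q y : in_tube (t + T *~ q) y <-> in_tube t y.
Proof.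
by split=> h i; have := h i; rewrite !periodicz.
Qed.

Lemma tube_bounded : exists2 M, 0 <= M & forall t y, in_tube t y -> cube M y.
Proof.
have [M1 hM1] := family_bounded T (fun j => let: And5 c _ _ _ _ := x1_C2 j in c).
have [M2 hM2] := family_bounded T (fun j => let: And5 c _ _ _ _ := x2_C2 j in c).
exists (`|M1| + `|M2|) => [|t y ty i]; first by rewrite addr_ge0.
have [q tq] := period_shift t T_gt0; have := (tube_shift t q y).2 ty i.
move=> /norm_between; apply.
  by apply: le_trans (hM1 i _ tq) _; exact: ler_norm.
by apply: le_trans (hM2 i _ tq) _; exact: ler_norm.
Qed.

(** The unknowns are indexed by the pairs of a grid index and a coordinate, and
    extended to all integers by periodicity; periodicity of the data carries the
    equation from the m + 1 grid points of one period to all of them. *)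
Lemma scheme_solution : \forall eta \near (0 : R)^'+, \forall h \near (0 : R)^'+,
  forall (m : nat) (eps : R), h = T / m.+1%:R -> 0 < eps ->
  exists Y : int -> 'rV[R]_n,
    [/\ forall k : int, Y (k + m.+1%:Z) = Y k, between h eta Y &
        forall k j, `|second_difference Y k 0 j - h ^+ 2 * force h Y k 0 j|
                      <= h ^+ 2 * eps].
Proof.
near=> eta.
have eta0 : 0 < eta by near: eta; exact: nbhs_right_gt.
have margin : uniform_margin eta by near: eta; exact: face_margin.
have gap (j : 'I_n) (t : R) (tT : 0 <= t <= T) := proj1 (margin j t tT).
near=> h.
have h0 : 0 < h by near: h; exact: nbhs_right_gt.
have signs : inward eta h by near: h; near: eta; exact: face_signs.
move=> m eps hE eps0.
have Th : T = m.+1%:R * h by rewrite hE mulrC divfK // pnatr_eq0.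
have [idx [idxM idxE idxK]] := grid_index m.
have gridT (i : 'I_m.+1) : 0 <= (i%:Z)%:~R * h <= T.
  apply/andP; split; first by rewrite mulr_ge0 ?ler0z // ltW.
  rewrite Th ler_pM2r // -[m.+1%:R]/(m.+1%:Z%:~R) ler_int.
  by have := ltn_ord i; lia.
have gridP (V : zmodType) (f : R -> V) (k : int) : periodic f T ->
    f (k%:~R * h) = f (((idx k)%:Z)%:~R * h).
  move=> fT; have [q kE] := idxE k; rewrite [in LHS]kE intrD mulrDl.
  by rewrite intrM -mulrA -Th (mulrzl T) periodicz.
pose Y (z : 'I_m.+1 * 'I_n -> R) k : 'rV[R]_n := \row_j z (idx k, j).
pose time (p : 'I_m.+1 * 'I_n) : R := (p.1%:Z)%:~R * h.
pose lo p := x1 p.2 (time p) + eta.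
pose hi p := x2 p.2 (time p) - eta.
have Ybetween z : in_box lo hi z -> between h eta (Y z).
  move=> zbox k j; have := zbox (idx k, j); rewrite /Y mxE /lo /hi /time /=.
  by rewrite -!gridP.
pose G z (p : 'I_m.+1 * 'I_n) := h ^+ 2 * force h (Y z) p.1%:Z 0 p.2 -
              second_difference (Y z) p.1%:Z 0 p.2.
have hh0 : 0 < h ^+ 2 by rewrite exprn_gt0.
have heps0 : 0 < h ^+ 2 * eps by rewrite mulr_gt0.
have [M M0 hM] := tube_bounded.
have [d d0 hd] := compact_unif_continuous (@compact_cylinder R n 0 T M N)
   v_continuous (divr_gt0 eps0 (ltr0n _ 2)).
have Yin z (i : 'I_m.+1) : in_box lo hi z ->
    (`[0, T] `*` cube M `*` cube N)%classic
      ((i%:Z)%:~R * h, Y z i%:Z, clamp_row N (backward h (Y z) i%:Z)).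
  move=> zbox; split; last by move=> j /=; rewrite mxE; exact: clamp_bound.
  split; first by rewrite /= in_itv; exact: gridT.
  apply: (hM ((i%:Z)%:~R * h)) => j.
  exact: between_shrink eta0 (Ybetween z zbox i%:Z j).
have [|//||||z zbox zG] := @poincare_miranda_approx R _ lo hi G (h ^+ 2 * eps).
- by move=> [i j]; exact: (gap j _ (gridT i)).
- (* The three bounds control, in this order, the positions, the velocities
     (a difference of two positions divided by h), and the second difference
     (four positions, for half of the tolerance). *)
  exists (Num.min d (Num.min (d * h / 2) (h ^+ 2 * eps / 8))).
    by rewrite !lt_min d0 !divr_gt0 ?mulr_gt0.
  move=> z z' zbox zbox' zz' [i j].
  have dz k l : `|Y z k 0 l - Y z' k 0 l| <= d /\
      `|Y z k 0 l - Y z' k 0 l| <= d * h / 2 /\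
      `|Y z k 0 l - Y z' k 0 l| <= h ^+ 2 * eps / 8.
    by have := zz' (idx k, l); rewrite !mxE !le_min => /and3P[].
  have fz : `|force h (Y z) i%:Z 0 j - force h (Y z') i%:Z 0 j| <= eps / 2.
    have hv := hd _ ((i%:Z)%:~R * h, Y z' i%:Z, clamp_row N (backward h (Y z') i%:Z))
      (Yin z i zbox).
    apply: le_trans (hv _).
      by rewrite /force; set u := v _; set u' := v _;
         have := coord_le_norm (u - u') j; rewrite !mxE.
    rewrite !prod_normE /= !ge_max subrr normr0 ltW //=; apply/andP; split.
      apply: norm_le_coord; first exact: ltW.
      by move=> l; have [] := dz i%:Z l; rewrite !mxE.
    apply: norm_le_coord; first exact: ltW.
    move=> l; rewrite !mxE; apply: le_trans (clamp_lip _ _ N_ge0) _.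
    rewrite -mulrBr normrM gtr0_norm ?invr_gt0 // mulrC ler_pdivrMr //.
    have [_ [dz1 _]] := dz i%:Z l; have [_ [dz2 _]] := dz (i%:Z - 1) l.
    by move: (norm_difference_le dz1 dz2); rewrite !mxE.
  have [_ [_ l1]] := dz i%:Z j; have [_ [_ l2]] := dz (i%:Z - 1) j.
  have [_ [_ l3]] := dz (i%:Z + 1) j.
  have {}fz : `|h ^+ 2 * force h (Y z) i%:Z 0 j - h ^+ 2 * force h (Y z') i%:Z 0 j|
       <= h ^+ 2 * eps / 2.
    by rewrite -mulrBr normrM gtr0_norm // -mulrA ler_pM2l.
  move: (norm_residual_le fz l3 l1 l2); rewrite /G /second_difference /=.
  by set f1 := force _ _ _ _ _; set f2 := force _ _ _ _ _; rewrite !mxE.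
- move=> z [i j] zbox zlo; rewrite /G subr_le0 /=.
  apply: (signs _ (Ybetween z zbox) i%:Z j (gridT i)).1.
  by rewrite /Y mxE idxK zlo.
- move=> z [i j] zbox zhi; rewrite /G subr_ge0 /=.
  apply: (signs _ (Ybetween z zbox) i%:Z j (gridT i)).2.
  by rewrite /Y mxE idxK zhi.
exists (Y z); have YM k (q : int) : Y z (k + q * m.+1%:Z) = Y z k.
  by apply/rowP => j; rewrite !mxE idxM.
split; first by move=> k; rewrite -[m.+1%:Z]mul1r YM.
  exact: Ybetween.
move=> k j; rewrite distrC; have := zG (idx k, j); rewrite /G /=.
have Yshift (s : int) : Y z (k + s) = Y z ((idx k)%:Z + s).
  by have [q kE] := idxE k; rewrite [in LHS]kE addrAC YM.
have Yk : Y z k = Y z (idx k)%:Z by rewrite -[k in LHS]addr0 Yshift addr0.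
have -> : second_difference (Y z) (idx k)%:Z = second_difference (Y z) k.
  by rewrite /second_difference !Yshift Yk.
suff -> : force h (Y z) (idx k)%:Z = force h (Y z) k by [].
rewrite /force /backward Yshift -Yk.
exact: (esym (gridP _ (fun t => v (t, _, _)) k (v_periodic _ _))).
Unshelve. all: by end_near. Qed.

(** The bound assumed on one period holds for all times, since the force and the
    tube are periodic. *)
Lemma truncated_force_le t (y w : 'rV[R]_n) : in_tube t y ->
  forall j, `|v (t, y, clamp_row N w) 0 j| <= K.
Proof.
move=> ty j; have [q tq] := period_shift t T_gt0.
rewrite -(periodicz q t (v_periodic y (clamp_row N w))).
apply: v_le => //; first exact/tube_shift.
by move=> i; rewrite mxE; exact: clamp_bound.
Qed.

Lemma scheme_sequence : exists2 eta : R, 0 < eta &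
  exists h : nat -> R, exists Y : nat -> int -> 'rV[R]_n, forall r,
  [/\ 0 < h r <= r.+1%:R^-1,
      exists m : nat, h r = T / m.+1%:R /\ forall k : int, Y r (k + m.+1%:Z) = Y r k,
      between (h r) eta (Y r) &
      forall k j, `|second_difference (Y r) k 0 j - h r ^+ 2 * force (h r) (Y r) k 0 j|
                  <= h r ^+ 2 * r.+1%:R^-1].
Proof.
have [eta [eta0 heta]] := filter_ex (filterI (nbhs_right_gt (0 : R)) scheme_solution).
exists eta => //.
have hr (r : nat) : \forall h \near (0 : R)^'+, h <= r.+1%:R^-1.
  by apply: nbhs_right_le; rewrite invr_gt0.
have /choice[h /choice[Y hY]] r : exists h (Y : int -> 'rV[R]_n),
  [/\ 0 < h <= r.+1%:R^-1,
      exists m : nat, h = T / m.+1%:R /\ forall k : int, Y (k + m.+1%:Z) = Y k,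
      between h eta Y &
      forall k j, `|second_difference Y k 0 j - h ^+ 2 * force h Y k 0 j|
                  <= h ^+ 2 * r.+1%:R^-1].
  have [e /= e0 he] := filterI heta (hr r).
  pose m := Num.bound (T / e).
  have h0 : 0 < T / m.+1%:R by rewrite divr_gt0.
  have hm : T / m.+1%:R < e.
    rewrite ltr_pdivrMr // mulrC -ltr_pdivrMr //.
    have /archi_boundP/lt_le_trans : 0 <= T / e by rewrite divr_ge0 // ltW.
    by apply; rewrite ler_nat.
  have [|hP hle] := he (T / m.+1%:R) _ h0.
    by rewrite /ball_ /= sub0r normrN gtr0_norm.
  have [|Y [Yper Ybox Yres]] := hP m r.+1%:R^-1 erefl; first by rewrite invr_gt0.
  by exists (T / m.+1%:R), Y; split => //; [rewrite h0|exists m].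
by exists h, Y.
Qed.

Section SchemeEstimates.
Variables (h eta eps : R) (m : nat) (Y : int -> 'rV[R]_n).
Hypotheses (h_gt0 : 0 < h) (eta_gt0 : 0 < eta) (eps_ge0 : 0 <= eps) (eps_le1 : eps <= 1).
Hypothesis h_def : h = T / m.+1%:R.
Hypothesis Y_periodic : forall k : int, Y (k + m.+1%:Z) = Y k.
Hypothesis Y_between : between h eta Y.
Hypothesis Y_residual : forall k j,
  `|second_difference Y k 0 j - h ^+ 2 * force h Y k 0 j| <= h ^+ 2 * eps.

Lemma between_in_tube k : in_tube (k%:~R * h) (Y k).
Proof. by move=> j; exact: between_shrink eta_gt0 (Y_between k j). Qed.

Lemma backward_increment k :
  `|backward h Y (k + 1) - backward h Y k - h *: force h Y k| <= h * eps.
Proof.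
have -> : backward h Y (k + 1) - backward h Y k - h *: force h Y k =
    h^-1 *: (second_difference Y k - h ^+ 2 *: force h Y k).
  rewrite /backward addrK -scalerBr [RHS]scalerBr scalerA expr2 mulKf ?gt_eqF //.
  congr (_ *: _ - _); rewrite /second_difference opprB scaler_nat mulr2n opprD.
  by rewrite !addrA [LHS](ACl (1*2*4*3)).
rewrite normrZ gtr0_norm ?invr_gt0 // mulrC ler_pdivrMr //.
apply: norm_le_coord => [|j]; first by rewrite !mulr_ge0 // ltW.
have -> : h * eps * h = h ^+ 2 * eps by ring.
by have := Y_residual k j; rewrite !mxE.
Qed.

Lemma backward_lipschitz k :
  `|backward h Y (k + 1) - backward h Y k| <= h * (K + 1).
Proof.
have hb := backward_increment k.
rewrite -[_ - _](subrK (h *: force h Y k)); apply: le_trans (ler_normD _ _) _.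
rewrite mulrDr addrC; apply: lerD.
  rewrite normrZ gtr0_norm // ler_pM2l //; apply: norm_le_coord => //.
  by move=> j; apply: truncated_force_le; exact: between_in_tube.
by apply: le_trans hb _; rewrite ler_pM2l.
Qed.

(** Over a full period the increments of Y sum to zero, while each of them differs
    from h times the velocity at k by a controlled amount. The resulting bound
    does not depend on h, which makes the velocities relatively compact. *)
Lemma backward_bounded k : `|backward h Y k| <= T * (K + 1).
Proof.
have Th : T = m.+1%:R * h by rewrite h_def mulrC divfK // pnatr_eq0.
(* The increments of f measure how far the velocity drifts from its value at
   k; their sum over a period is - T times this value. *)
pose f (i : int) := Y i - (i%:~R * h) *: backward h Y k.
have fstep i : k <= i < k + m.+1%:Z -> `|f (i + 1) - f i| <= h * (T * (K + 1)).
  move=> /andP[ki im].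
  have -> : f (i + 1) - f i = h *: (backward h Y (i + 1) - backward h Y k).
    rewrite scalerBr [in RHS]/backward addrK scalerA mulfV ?gt_eqF // scale1r.
    rewrite /f intrD mulrDl mul1r scalerDl !opprD !opprK !addrA.
    by rewrite [LHS](ACl (1*4*5*2*3)) /= addrK.
  rewrite normrZ gtr0_norm // ler_pM2l //.
  have ki1 : k <= i + 1 by lia.
  apply: le_trans (increments_le ki1 (fun l _ => backward_lipschitz l)) _.
  rewrite mulrA ler_wpM2r ?addr_ge0 // Th ler_pM2r // -[m.+1%:R]/(m.+1%:Z%:~R).
  by rewrite ler_int; lia.
have km : k <= k + m.+1%:Z by lia.
have := increments_le km fstep.
have -> : f (k + m.+1%:Z) - f k = - (T *: backward h Y k).
  rewrite /f Y_periodic intrD mulrDl -[m.+1%:Z%:~R]/(m.+1%:R) -Th scalerDl.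
  by rewrite !opprD !opprK !addrA [LHS](ACl (1*4*5*2*3)) /= addrK subrr add0r.
rewrite normrN normrZ gtr0_norm //.
have -> : (k + m.+1%:Z - k)%:~R * (h * (T * (K + 1))) = T * (T * (K + 1)).
  rewrite addrAC subrr add0r [LHS]mulrA -[X in X * _]/(m.+1%:R * h) -Th.
  by [].
by rewrite ler_pM2l.
Qed.

End SchemeEstimates.

(** Both equations x' = w and w' = v (t, x, clamp w) are instances of
    limit_derivative, applied to the grid solutions and to their backward
    differences. *)
Lemma truncated_solution : exists x w : R -> 'rV[R]_n,
  [/\ forall t : R, is_derive t 1 x (w t),
      forall t : R, is_derive t 1 w (v (t, x t, clamp_row N (w t))),
      periodic x T & forall t j, x1 j t < x t 0 j < x2 j t].
Proof.
have [eta eta0 [h [Y hY]]] := scheme_sequence.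
have [U [UU sU]] := @ultraFilterLemma nat \oo _.
have h0 r : 0 < h r by have [/andP[]] := hY r.
have small (eps : R) : 0 < eps -> \forall r \near U, r.+1%:R^-1 <= eps.
  move=> eps0; apply: sU; exists (Num.bound eps^-1) => // r /= hr.
  rewrite invf_ple ?posrE //; have := archi_boundP (ltW (_ : 0 < eps^-1)).
  rewrite invr_gt0 => /(_ eps0)/ltW/le_trans; apply.
  by rewrite ler_nat ltnW // ltnS.
have hsmall (eps : R) : 0 < eps -> \forall r \near U, h r <= eps.
  by move=> /small; apply: filterS => r; apply: le_trans; have [/andP[]] := hY r.
have h_cvg : h r @[r --> U] --> 0.
  apply/cvgrPdist_le => eps /hsmall; apply: filterS => r.
  by rewrite sub0r normrN gtr0_norm.
have eps_ge0 r : 0 <= r.+1%:R^-1 :> R by rewrite invr_ge0.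
have eps_le1 r : r.+1%:R^-1 <= 1 :> R by rewrite invf_le1 ?ler1n ?ltr0n.
have Ytube r k : in_tube (k%:~R * h r) (Y r k).
  by have [_ _ Yb _] := hY r; exact: between_in_tube eta0 Yb k.
pose D r := backward (h r) (Y r).
have D_incr r k : `|D r (k + 1) - D r k - h r *: force (h r) (Y r) k|
    <= h r * r.+1%:R^-1.
  by have [_ _ _ Yr] := hY r; exact: backward_increment.
have D_lip r k : `|D r (k + 1) - D r k| <= h r * (K + 1).
  by have [_ _ Yb Yr] := hY r; exact: (backward_lipschitz (h0 r) eta0 (eps_ge0 r) (eps_le1 r) Yb Yr).
have D_bnd r k : cube (T * (K + 1)) (D r k).
  move=> j; apply: le_trans (coord_le_norm _ _) _.
  have [_ [m [hm Yper]] Yb Yr] := hY r.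
  exact: (backward_bounded (h0 r) eta0 (eps_ge0 r) (eps_le1 r) hm Yper Yb Yr).
have [M M0 hM] := tube_bounded.
have Y_bnd r k : cube M (Y r k) by apply: hM (Ytube r k).
have Y_incr r k : Y r (k + 1) - Y r k = h r *: D r (k + 1).
  by rewrite /D /backward addrK scalerA mulfV ?scale1r // gt_eqF.
have Y_lip r k : `|Y r (k + 1) - Y r k| <= h r * (T * (K + 1)).
  rewrite Y_incr normrZ gtr0_norm // ler_pM2l //.
  apply: norm_le_coord; last exact: D_bnd.
  by rewrite mulr_ge0 ?addr_ge0 // ltW.
have /choice[x hx] : forall s, exists p : 'rV[R]_n,
    Y r (Num.floor (s / h r)) @[r --> U] --> p.
  move=> s.
  have [p _ hp] := ultra_compact_cvg UU (@compact_cube R n M)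
    (fun r => Y_bnd r (Num.floor (s / h r))).
  by exists p.
have /choice[w hw] : forall s, exists p : 'rV[R]_n,
    D r (Num.floor (s / h r)) @[r --> U] --> p.
  move=> s.
  have [p _ hp] := ultra_compact_cvg UU (@compact_cube R n (T * (K + 1)))
    (fun r => D_bnd r (Num.floor (s / h r))).
  by exists p.
exists x, w; split.
  (* The increment of Y at k is h times the velocity at k + 1; replacing it by
     the velocity at k costs a term of order h ^ 2. *)
- move=> t; apply: (@limit_derivative R _ U _ h Y D x w h0 h_cvg hx t (hw t)).
    move=> eps eps0; have K1 : 0 < K + 1 by apply: ltr_wpDl.
    exists (eps / (2 * (K + 1))); first by rewrite divr_gt0 ?mulr_gt0.
    apply: nearW => r k l kt lt.
    apply: le_trans (grid_lipschitz (h0 r) (D_lip r) k l) _.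
    rewrite -ler_pdivlMr //.
    have := ler_distD t (k%:~R * h r) (l%:~R * h r); rewrite (distrC t).
    move=> /le_trans; apply; apply: le_trans (lerD kt lt) _.
    by rewrite div2D.
  move=> eps eps0; have K1 : 0 < K + 1 by apply: ltr_wpDl.
  have : \forall r \near U, h r <= eps / (K + 1) by apply: hsmall; rewrite divr_gt0.
  apply: filterS => r hr k; rewrite Y_incr -scalerBr normrZ gtr0_norm // ler_pM2l //.
  by apply: le_trans (D_lip r k) _; rewrite -ler_pdivlMr.
- move=> t; apply: (@limit_derivative R _ U _ h D (fun r => force (h r) (Y r)) w
    (fun t => v (t, x t, clamp_row N (w t))) h0 h_cvg hw t).
  + rewrite /force /=; apply: (@continuous_cvg _ _ _ U _ _ v); first exact: v_continuous.
    apply: (@cvg_pair _ _ _ U (nbhs (t, x t)) (nbhs (clamp_row N (w t))));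
      first apply: (@cvg_pair _ _ _ U (nbhs t) (nbhs (x t))).
    * exact: floor_cvg.
    * exact: hx.
    * apply: (@continuous_cvg _ _ _ U _ _ (clamp_row N)); last exact: hw.
      exact: clamp_row_continuous.
  + move=> eps eps0.
    have [d d0 hd] := compact_unif_continuous
      (@compact_cylinder R n (t - 1) (t + 1) M N) v_continuous eps0.
    (* C is a common Lipschitz constant for time, position and velocity as
   functions of the grid time. *)
pose C := 1 + T * (K + 1) + (K + 1).
    have TK0 : 0 <= T * (K + 1) by rewrite mulr_ge0 ?addr_ge0 // ltW.
    have C1 : 1 <= C by rewrite /C -addrA lerDl !addr_ge0.
    have C2 : T * (K + 1) <= C by rewrite /C addrAC lerDr !addr_ge0.
    have C3 : K + 1 <= C by rewrite /C lerDr !addr_ge0.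
    exists (Num.min 1 (d / (2 * C))).
      by rewrite lt_min ltr01 divr_gt0 // mulr_gt0 //; exact: lt_le_trans C1.
    apply: nearW => r k l; rewrite !le_min => /andP[k1 kd] /andP[l1 ld].
    have kl : `|k%:~R * h r - l%:~R * h r| * C <= d.
      rewrite -ler_pdivlMr; last exact: lt_le_trans C1.
      have := ler_distD t (k%:~R * h r) (l%:~R * h r); rewrite (distrC t).
      move=> /le_trans; apply; apply: le_trans (lerD kd ld) _.
      by rewrite div2D //; exact: lt_le_trans C1.
    apply: hd.
      split; last by move=> j; rewrite mxE; exact: clamp_bound.
      split; last exact: Y_bnd.
      by rewrite /= in_itv /=; move: k1; rewrite ler_distl lerBlDr.
    have le_d c : c <= C -> `|k%:~R * h r - l%:~R * h r| * c <= d.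
      by move=> cC; apply: le_trans kl; rewrite ler_wpM2l.
    rewrite !prod_normE /= !ge_max -andbA; apply/and3P; split.
    * by rewrite -[leLHS]mulr1; exact: le_d.
    * apply: le_trans (grid_lipschitz (h0 r) (Y_lip r) k l) _; exact: le_d.
    * apply: le_trans (clamp_row_lip _ _ N_ge0) _.
      apply: le_trans (grid_lipschitz (h0 r) (D_lip r) k l) _; exact: le_d.
  + move=> eps /small; apply: filterS => r hr k.
    by apply: le_trans (D_incr r k) _; rewrite ler_pM2l.
- move=> s; have hs := hx s.
  suff : Y r (Num.floor (s / h r)) @[r --> U] --> x (s + T).
    by move=> hs'; exact: (cvg_unique _ hs' hs).
  have -> : (fun r => Y r (Num.floor (s / h r))) =
            (fun r => Y r (Num.floor ((s + T) / h r))).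
    apply/funext => r; have [_ [m [hm Yper]] _ _] := hY r.
    have -> : (s + T) / h r = s / h r + m.+1%:Z%:~R.
      rewrite mulrDl hm; congr (_ + _); rewrite invf_div mulrC divfK //.
      by rewrite gt_eqF.
    by rewrite floorDrz ?intr_int // intrKfloor Yper.
  exact: hx.
- move=> t j.
  have cj : Y r (Num.floor (t / h r)) 0 j @[r --> U] --> x t 0 j.
    apply: (@continuous_cvg _ _ _ U _ _ (fun u : 'rV[R]_n => u 0 j)); last exact: hx.
    exact: coord_continuous.
  have cf (f : R -> R) : continuous f ->
     f ((Num.floor (t / h r))%:~R * h r) @[r --> U] --> f t.
    by move=> fc; apply: (@continuous_cvg _ _ _ U _ _ f); [exact: fc|exact: floor_cvg].
  have c1 : continuous (x1 j) by case: (x1_C2 j).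
  have c2 : continuous (x2 j) by case: (x2_C2 j).
  have Yb r : x1 j ((Num.floor (t / h r))%:~R * h r) + eta <=
      Y r (Num.floor (t / h r)) 0 j <= x2 j ((Num.floor (t / h r))%:~R * h r) - eta.
    by have [_ _ Yb _] := hY r; exact: Yb.
  have lower : x1 j t + eta <= x t 0 j.
    apply: (ler_cvg_to (cvgD (cf _ c1) (cvg_cst eta)) cj).
    by apply: nearW => r; case/andP: (Yb r).
  have upper : x t 0 j <= x2 j t - eta.
    apply: (ler_cvg_to cj (cvgB (cf _ c2) (cvg_cst eta))).
    by apply: nearW => r; case/andP: (Yb r).
  apply/andP; split; first by apply: lt_le_trans lower; rewrite ltrDl.
  by apply: le_lt_trans upper _; rewrite gtrBl.
Qed.

End DifferenceScheme.

(** * The truncation level and the periodic solution *)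

(** With d = 2 - gamma, half of N ^ 2 dominates A as soon as N is at least 1 and
    2 A, and the other half dominates c N ^ gamma as soon as N ^ d is at least
    2 c. *)
Lemma subquadratic_level (R : realType) (A c gamma L : R) :
  0 <= A -> 0 <= c -> 0 <= gamma < 2 ->
  exists2 N, 1 <= N /\ L <= N & A + c * N `^ gamma <= N ^+ 2.
Proof.
move=> A0 c0 /andP[g0 g2]; pose d := 2 - gamma; have d0 : 0 < d by rewrite subr_gt0.
pose q := (2 * c) `^ d^-1; have q0 : 0 <= q := powR_ge0 _ _.
pose N := 1 + `|L| + 2 * A + q.
have L0 := normr_ge0 L; have LN := ler_norm L.
have N1 : 1 <= N by rewrite /N; lra.
exists N; first by split=> //; rewrite /N; lra.
have N0 : 0 < N := lt_le_trans ltr01 N1.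
have cN : 2 * c <= N `^ d.
  have -> : 2 * c = q `^ d.
    by rewrite /q -powRrM mulVf ?gt_eqF // powRr1 // mulr_ge0.
  apply: ge0_ler_powR; [exact: ltW|by rewrite nnegrE|by rewrite nnegrE ltW|].
  by rewrite /N; lra.
have E : N `^ gamma * N `^ d = N ^+ 2.
  rewrite -powRD; last by rewrite (gt_eqF N0) implybT.
  by rewrite addrC subrK powR_mulrn // ltW.
have h1 : 2 * c * N `^ gamma <= N ^+ 2.
  by rewrite -E mulrC ler_wpM2l // powR_ge0.
have h2 : 2 * A <= N ^+ 2.
  rewrite expr2; apply: (@le_trans _ _ N); first by rewrite /N; lra.
  by rewrite ler_peMl // ltW.
by lra.
Qed.

Lemma coord_le_euclidean (R : realType) n (u : 'rV[R]_n) j :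
  `|u 0 j| <= euclidean_norm u.
Proof.
rewrite -sqrtr_sqr ler_wsqrtr // (bigD1 j) //= lerDl.
by apply: sumr_ge0 => i _; exact: sqr_ge0.
Qed.

Lemma euclidean_le_coord (R : realType) n (u : 'rV[R]_n) C :
  0 <= C -> (forall i, `|u 0 i| <= C) -> euclidean_norm u <= n%:R * C.
Proof.
move=> C0 uC; rewrite -[leRHS]ger0_norm ?mulr_ge0 // -sqrtr_sqr ler_wsqrtr //.
apply: (@le_trans _ _ (\sum_(i < n) C ^+ 2)).
  by apply: ler_sum => i _; rewrite -real_normK ?num_real // lerXn2r ?nnegrE.
rewrite sumr_const card_ord exprMn -[leLHS]mulr_natl ler_wpM2r ?sqr_ge0 //.
by rewrite -natrX ler_nat; case: (n) => // k; rewrite expnS leq_pmulr // expn1.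
Qed.

(** The exponent is replaced by the nonnegative one Num.max 0 (2 - delta), which
    is harmless above 1; monotonicity in the base then gives a bound that
    depends on the truncation level only. *)
Lemma growth_bound (R : realType) n (b delta C e : R) : 1 <= e -> e <= n%:R * C ->
  0 <= C -> b * e `^ (2 - delta) <=
    `|b| * n%:R `^ (Num.max 0 (2 - delta)) * C `^ (Num.max 0 (2 - delta)).
Proof.
move=> e1 enC C0; set g := Num.max _ _.
have e0 : 0 <= e by apply: le_trans e1.
have g0 : 0 <= g by rewrite le_max lexx.
apply: le_trans (ler_wpM2r (powR_ge0 _ _) (ler_norm b)) _.
rewrite -mulrA ler_wpM2l // -powRM //.
apply: (@le_trans _ _ (e `^ g)); first by rewrite ler_powR // le_max lexx orbT.
by apply: ge0_ler_powR; rewrite ?nnegrE ?mulr_ge0.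
Qed.

Theorem theorem3p3 (R : realType) (T : R) (n : nat)
  (v : R * 'rV[R]_n * 'rV[R]_n -> 'rV[R]_n)
  (x1 x2 : 'I_n -> R -> R) (a b delta : R)
  (T_gt0 : 0 < T) (n_ge1 : (1 <= n)%N)
  (v_smooth : smooth v)
  (v_periodic : forall x w : 'rV[R]_n, periodic (fun t : R => v (t, x, w)) T)
  (x1_smooth : forall j : 'I_n, smooth (x1 j))
  (x2_smooth : forall j : 'I_n, smooth (x2 j))
  (x1_periodic : forall j : 'I_n, periodic (x1 j) T)
  (x2_periodic : forall j : 'I_n, periodic (x2 j) T)
  (x1_lt_x2 : forall (t : R) (j : 'I_n), x1 j t < x2 j t)
  (x1_lower : forall (t : R) (j : 'I_n) (y w : 'rV[R]_n),
     y 0 j = x1 j t -> w 0 j = (x1 j)^`() t ->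
     (forall i : 'I_n, i != j -> x1 i t <= y 0 i <= x2 i t) ->
     (x1 j)^`(2) t > v (t, y, w) 0 j)
  (x2_upper : forall (t : R) (j : 'I_n) (y w : 'rV[R]_n),
     y 0 j = x2 j t -> w 0 j = (x2 j)^`() t ->
     (forall i : 'I_n, i != j -> x1 i t <= y 0 i <= x2 i t) ->
     (x2 j)^`(2) t < v (t, y, w) 0 j)
  (delta_gt0 : 0 < delta)
  (* w = 0 is excluded only when 2 - delta < 0: a negative power of 0 has no
     meaning, while powR assigns it the value 0. *)
  (v_growth : forall (t : R) (x w : 'rV[R]_n), w != 0 \/ delta <= 2 ->
     euclidean_norm (v (t, x, w)) <= a + b * euclidean_norm w `^ (2 - delta)) :
  exists x : R -> 'rV[R]_n,
    [/\ is_solution v x,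
        periodic x T &
        forall (t : R) (j : 'I_n), x1 j t < x t 0 j < x2 j t].
Proof.
have v_cont : continuous v := v_smooth 0.
have c1 j := smooth_C2 (x1_smooth j); have c2 j := smooth_C2 (x2_smooth j).
have [B B0 tubeB] := tube_bounded T_gt0 c1 c2 x1_periodic x2_periodic.
have [D1 hD1] := family_bounded T (fun j => let: And5 _ _ c _ _ := c1 j in c).
have [D2 hD2] := family_bounded T (fun j => let: And5 _ _ c _ _ := c2 j in c).
have [K0 hK0] := compact_bounded_norm (@compact_cylinder R n 0 T B 1) v_cont.
pose g := Num.max 0 (2 - delta).
have g02 : 0 <= g < 2 by rewrite le_max lexx /= gt_max ltr0n gtrBl.
pose c := `|b| * n%:R `^ g.
have c0 : 0 <= c by rewrite mulr_ge0 // powR_ge0.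
pose A := `|K0| + `|a| + 1.
have A1 : 1 <= A by rewrite lerDr addr_ge0.
have [N [N1 NL] ANc] := @subquadratic_level R (8 * B * A) (8 * B * c) g
  (`|D1| + `|D2|) ltac:(by rewrite !mulr_ge0 // (le_trans ler01))
  ltac:(by rewrite !mulr_ge0) g02.
have N0 : 0 < N := lt_le_trans ltr01 N1.
pose K := A + c * N `^ g.
have cN0 : 0 <= c * N `^ g by rewrite mulr_ge0 // powR_ge0.
have K_gt0 : 0 < K by apply: lt_le_trans ltr01 _; rewrite -[1]addr0 lerD.
have BKN : 8 * B * K <= N ^+ 2 by rewrite mulrDr mulrA.
have v_le t (y w : 'rV[R]_n) : 0 <= t <= T -> in_tube x1 x2 t y ->
    (forall i, `|w 0 i| <= N) -> forall j, `|v (t, y, w) 0 j| <= K.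
  move=> tT ty wN j.
  (* Small velocities are handled by compactness, as the growth assumption gives
     no bound near w = 0 when the exponent is negative. *)
  have [e1|e1] := leP (euclidean_norm w) 1.
    apply: le_trans (coord_le_norm _ _) _.
    apply: (@le_trans _ _ K0).
      apply: hK0; split; last first.
        by move=> i /=; apply: le_trans (coord_le_euclidean _ _) e1.
      by split; [rewrite /= in_itv|exact: tubeB ty].
    apply: le_trans (ler_norm _) _; rewrite /K /A -!addrA lerDl !addr_ge0 //.
  have w0 : w != 0.
    apply: contraTneq e1 => ->; rewrite -leNgt /euclidean_norm.
    by rewrite big1 ?sqrtr0 // => i _; rewrite mxE expr0n.
  apply: le_trans (coord_le_euclidean _ _) _.
  apply: le_trans (v_growth _ _ _ (or_introl w0)) _.
  apply: lerD.
    by apply: le_trans (ler_norm _) _; rewrite /A addrAC lerDr addr_ge0.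
  by apply: growth_bound; [exact: ltW|exact: (euclidean_le_coord (ltW N0) wN)|exact: ltW].
have N_ge0 := ltW N0; have K_ge0 := ltW K_gt0.
have dx1_le j t : 0 <= t <= T -> `|(x1 j)^`()%classic t| <= N.
  move=> /(hD1 j)/le_trans; apply; apply: le_trans (ler_norm _) _.
  by apply: le_trans NL; rewrite lerDl.
have dx2_le j t : 0 <= t <= T -> `|(x2 j)^`()%classic t| <= N.
  move=> /(hD2 j)/le_trans; apply; apply: le_trans (ler_norm _) _.
  by apply: le_trans NL; rewrite lerDr.
have [x [w [dx dw xT xbox]]] := truncated_solution T_gt0 v_cont v_periodic c1 c2
  x1_periodic x2_periodic x1_lt_x2 x1_lower x2_upper N_ge0 K_ge0 dx1_le dx2_le v_le.
have xtube t : in_tube x1 x2 t (x t).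
  by move=> j; case/andP: (xbox t j) => /ltW -> /ltW ->.
have w_le t j : `|w t 0 j| <= N.
  apply: (landau_inequality (fun s => is_derive_coord j (dx s))
    (fun s => is_derive_coord j (dw s)) _ _ K_gt0 N0 BKN) => s.
    exact: tubeB (xtube s) j.
  exact: (truncated_force_le T_gt0 v_periodic x1_periodic x2_periodic N_ge0 v_le).
have clampE t : clamp_row N (w t) = w t.
  by apply/rowP => j; rewrite mxE clamp_id.
have xE : x^`() = w.
  by apply/funext => t; rewrite derive1E; apply: derive_val.
exists x; split=> // t; split.
- exact: (@ex_derive _ _ _ _ _ _ _ (dx t)).
- by rewrite xE; exact: (@ex_derive _ _ _ _ _ _ _ (dw t)).
- move=> j; rewrite derive1nS derive1n1 xE derive1E.
  by rewrite (@derive_val _ _ _ _ _ _ _ (dw t)) clampE.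
Qed.
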